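(* Let $K$ be an infinite field, $R = K[x_1,\ldots,x_n]$, and let $I \subseteq R$ be a graded ideal. Suppose that the modules $a_{\mathbf{x}}^i(I)$ have finite length for all $i \in \{1,\ldots,n\}$. Let $<$ be the reverse lexicographic order on $R$ with $x_1 > x_2 > \cdots > x_n$, and let $\mathrm{in}_<(I)$ be the initial ideal of $I$. Then for any two numbers $i,j \in \mathbb{N}$ one has: 1. $\beta_{i,i+j}(I)$ is extremal if and only if $\beta_{i,i+j}(\mathrm{in}_<(I))$ is extremal; 2. if $\beta_{i,i+j}(I)$ is extremal, then $\beta_{i,i+j}(I) = \beta_{i,i+j}(\mathrm{in}_<(I))$.
   Context: $R$ carries the standard grading, and a graded ideal is an ideal generated by homogeneous elements. For a graded ideal $I \subseteq R$ put $I_0 = I$ and $I_i = I_{i-1} + (x_{n-i+1})$ for $i \in \{1,\ldots,n\}$, and define, with respect to the sequence $\mathbf{x} = x_n, x_{n-1}, \ldots, x_1$, $$a_{\mathbf{x}}^i(I) = \frac{I_{i-1} : (x_{n-i+1})}{I_{i-1}}, \qquad i = 1,\ldots,n.$$ For a finitely generated graded $R$-module $M$, the graded Betti numbers are $\beta_{i,j}(M) = \dim_K \mathrm{Tor}_i^R(M,K)_j$. A graded Betti number $\beta_{i,i+j}(M) \neq 0$ is called extremal if $\beta_{k,k+l}(M) = 0$ for all $(k,l) \neq (i,j)$ with $k \geqslant i$ and $l \geqslant j$. *)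

(* Defs.v *)
From HB Require Import structures.
From mathcomp Require Import all_boot all_order all_algebra.
From mathcomp Require Import mpoly.

Set Implicit Arguments.
Unset Strict Implicit.
Unset Printing Implicit Defensive.

Import Order.TTheory GRing.Theory.

Local Open Scope ring_scope.

Definition infinite_field (K : fieldType) : Prop :=
  forall s : seq K, exists x : K, x \notin s.

Section Ideals.

Variables (n : nat) (K : fieldType).

Local Notation R := {mpoly K[n]}.

Definition is_ideal (I : R -> Prop) : Prop :=
  [/\ I 0,
      forall p q, I p -> I q -> I (p + q) &
      forall c p, I p -> I (c * p)].

Definition incl (I J : R -> Prop) : Prop := forall p, I p -> J p.

Definition same_ideal (I J : R -> Prop) : Prop := forall p, I p <-> J p.

Definition ideal_gen (S : R -> Prop) (p : R) : Prop :=
  exists (k : nat) (c g : 'I_k -> R),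
    (forall a, S (g a)) /\ p = \sum_a c a * g a.

Definition principal (x : R) : R -> Prop := ideal_gen (fun p => p = x).

Definition ideal_add (I J : R -> Prop) (p : R) : Prop :=
  exists a b, [/\ I a, J b & p = a + b].

Definition colon (I J : R -> Prop) (p : R) : Prop :=
  forall q, J q -> I (p * q).

Definition graded_ideal (I : R -> Prop) : Prop :=
  exists S : R -> Prop,
    (forall p, S p -> exists d, p \is d.-homog) /\ same_ideal I (ideal_gen S).

(* The library numbers the variables from 0, so [xvar k] is x_{k+1}; the value
   0 for k >= n is junk. *)
Definition xvar (k : nat) : R :=
  if insub k is Some a then 'X_(a : 'I_n) else 0.

(* I_0 = I and I_i = I_{i-1} + (x_{n-i+1}) for 1 <= i <= n. *)
Fixpoint chain (I : R -> Prop) (i : nat) : R -> Prop :=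
  if i is i'.+1 then ideal_add (chain I i') (principal (xvar (n - i'.+1)))
  else I.

(* M / N is a nonzero module without proper nonzero submodule; submodules of
   M / N are the ideals L with N <= L <= M. *)
Definition simple_quotient (M N : R -> Prop) : Prop :=
  [/\ incl N M, ~ incl M N &
      forall L, is_ideal L -> incl N L -> incl L M ->
        same_ideal L N \/ same_ideal L M].

(* M / N has a composition series C 0 / N < C 1 / N < ... < C l / N. *)
Definition finite_length_quotient (M N : R -> Prop) : Prop :=
  exists (l : nat) (C : nat -> R -> Prop),
    [/\ forall k, (k <= l)%N -> is_ideal (C k),
        same_ideal (C 0%N) N,
        same_ideal (C l) M &
        forall k, (k < l)%N -> simple_quotient (C k.+1) (C k)].

(* The module a_x^i(I) = (I_{i-1} : (x_{n-i+1})) / I_{i-1}, for 1 <= i <= n. *)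
Definition annihilator_finite_length (I : R -> Prop) (i : nat) : Prop :=
  finite_length_quotient
    (colon (chain I i.-1) (principal (xvar (n - i)))) (chain I i.-1).

End Ideals.

Section InitialIdeal.

Variables (n : nat) (K : fieldType).

(* The (degree) reverse lexicographic order with x_1 > ... > x_n: for equal
   degrees, x^a < x^b iff the last nonzero entry of b - a is negative.  The
   library's order on monomials compares exponents from the first one on and
   is the graded lexicographic order. *)
Definition revlex_lt (a b : 'X_{1..n}) : bool :=
  (mdeg a < mdeg b)%N ||
  ((mdeg a == mdeg b) &&
   [exists k : 'I_n,
     (b k < a k)%N && [forall l : 'I_n, (k < l)%N ==> (a l == b l)]]).

Definition is_initial_monomial (f : {mpoly K[n]}) (m : 'X_{1..n}) : Prop :=
  m \in msupp f /\
  forall m', m' \in msupp f -> m' != m -> revlex_lt m' m.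

Definition initial_ideal (I : {mpoly K[n]} -> Prop) : {mpoly K[n]} -> Prop :=
  ideal_gen (fun p => exists f m,
    [/\ I f, is_initial_monomial f m & p = 'X_[m]]).

End InitialIdeal.

Section Betti.

Variables (n : nat) (K : fieldType).

Local Notation R := {mpoly K[n]}.

(* p lies in the component R_t of the standard grading; R_t = 0 for t < 0. *)
Definition in_degree (t : int) (p : R) : Prop :=
  match t with
  | Posz d => p \is d.-homog
  | Negz _ => p = 0
  end.

(* An exact complex  ... -> F_1 -> F_0 -> I -> 0  of graded R-modules with
   F_i = \bigoplus_a R(- gr_deg i a) of finite rank.  Elements of F_i are row
   vectors and maps act by multiplication on the right; the homogeneity
   conditions say that the maps have degree 0.  Neither minimality nor finite
   length is required. *)
Record graded_free_resolution (I : R -> Prop) := GradedFreeResolution {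
  gr_rank : nat -> nat;
  gr_deg : forall i, 'I_(gr_rank i) -> int;
  gr_aug : 'cV[R]_(gr_rank 0);
  gr_diff : forall i, 'M[R]_(gr_rank i.+1, gr_rank i);
  gr_aug_homog : forall a, in_degree (gr_deg a) (gr_aug a 0);
  gr_diff_homog : forall i a b,
    in_degree (gr_deg a - gr_deg b) (gr_diff i a b);
  gr_aug_onto : forall p, I p <-> exists u : 'rV_(gr_rank 0),
    p = (u *m gr_aug) 0 0;
  gr_exact0 : forall u : 'rV_(gr_rank 0),
    u *m gr_aug = 0 <-> exists v, u = v *m gr_diff 0;
  gr_exactS : forall i (u : 'rV_(gr_rank i.+1)),
    u *m gr_diff i = 0 <-> exists v, u = v *m gr_diff i.+1
}.

Section Tor.

Variables (I : R -> Prop) (F : graded_free_resolution I).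

(* As K = R / (x_1, ..., x_n), the vector space F_i \otimes_R K is K^(rank F_i),
   with the a-th basis vector in degree gr_deg i a, and the differentials are
   reduced to their constant terms. *)
Definition tor_diff (i : nat) : 'M[K]_(gr_rank F i.+1, gr_rank F i) :=
  map_mx (mcoeff 0%MM) (gr_diff F i).

(* Its row space is (F_i \otimes K)_j. *)
Definition tor_degree (i : nat) (j : int) : 'M[K]_(gr_rank F i) :=
  diag_mx (\row_a (@gr_deg I F i a == j)%:R).

Definition tor_cycles (i : nat) (j : int) : 'M[K]_(gr_rank F i) :=
  match i with
  | 0%N => tor_degree 0 j
  | i'.+1 => (tor_degree i'.+1 j :&: kermx (tor_diff i'))%MS
  end.

Definition tor_boundaries (i : nat) (j : int) :
    'M[K]_(gr_rank F i.+1, gr_rank F i) :=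
  tor_degree i.+1 j *m tor_diff i.

(* beta_{i,j}(I) = dim_K Tor_i^R(I, K)_j; the rank of a complement of the
   boundaries in the cycles is the dimension of the quotient. *)
Definition betti (i j : nat) : nat :=
  \rank (tor_cycles i j%:Z :\: tor_boundaries i j%:Z)%MS.

End Tor.

End Betti.

(* b i j stands for beta_{i,j}. *)
Definition extremal (b : nat -> nat -> nat) (i j : nat) : Prop :=
  b i (i + j)%N <> 0%N /\
  forall k l, (i <= k)%N -> (j <= l)%N -> (k, l) <> (i, j) ->
    b k (k + l)%N = 0%N.

(* Main.v *)
(* Both sides of the theorem are determined by the graded pieces of the
   annihilators (I_r : y) / I_r, with y = x_{n-r}.

   Let F be a graded free resolution of R / I and let P_r be the ideal of the last
   r variables.  The sequence 0 -> R/P_r -> R/P_r -> R/P_{r+1} -> 0, whose first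
   map is multiplication by y, gives a long exact sequence relating the homology
   of F / P_r F to that of F / P_{r+1} F.  It starts at r = 0, where only
   H_0 = R / I survives, and ends at r = n with Tor^R(R/I, K), while
   H_0(F / P_r F) = R / I_r.  Since the annihilators vanish in large degrees, the
   sequence shows that the Betti numbers beta_{k,k+l}(I) with k >= i, l >= j vanish
   iff the annihilators with r < n - i vanish in the degrees >= j - 1, and that an
   extremal beta_{i,i+j}(I) is carried by connecting isomorphisms to the piece of
   degree j - 1 of the annihilator with r = n - i - 1.

   For the reverse lexicographic order, passing to initial ideals commutes with
   adding the last variables and with the colon by the next one, and monomials
   initial for L but not for J give a basis of L / J.  So the annihilators of I and
   of in(I) have the same Hilbert function. *)

Require Import Defs.
From mathcomp Require Import all_boot all_order all_algebra.
From mathcomp Require Import mpoly.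
From mathcomp Require Import zify ring.
From Stdlib Require Import Classical ClassicalEpsilon.

Set Implicit Arguments.
Unset Strict Implicit.
Unset Printing Implicit Defensive.

Import Order.TTheory GRing.Theory Num.Theory.

Local Open Scope ring_scope.

(** * Supports and homogeneous components of polynomials *)

Section Support.

Variables (n : nat) (K : fieldType).
Local Notation R := {mpoly K[n]}.
Implicit Types (p q c g : R) (m : 'X_{1..n}) (t : int).

Lemma mcoeffM_neq0 p q m : (p * q)@_m != 0 ->
  exists m1 m2, [/\ m = (m1 + m2)%MM, p@_m1 != 0 & q@_m2 != 0].
Proof.
rewrite -mcoeff_msupp => /msuppM_le /allpairsP[[m1 m2] /= [h1 h2 ->]].
by exists m1, m2; rewrite -!mcoeff_msupp.
Qed.

Lemma mcoeffMXl p m m' : ('X_[m] * p)@_(m + m')%MM = p@_m'.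
Proof. by rewrite mulrC mcoeffMX. Qed.

Definition mfilter (Q : pred 'X_{1..n}) p : R :=
  \sum_(m <- msupp p | Q m) p@_m *: 'X_[m].

Lemma mcoeff_filter Q p m : (mfilter Q p)@_m = if Q m then p@_m else 0.
Proof.
rewrite /mfilter raddf_sum /=.
have E m' : (p@_m' *: 'X_[m'])@_m = if m' == m then p@_m else 0.
  by rewrite mcoeffZ mcoeffX; case: eqP => [->|]; rewrite ?mulr1 ?mulr0.
under eq_bigr do rewrite E.
rewrite -big_mkcondr /=; case: (boolP (m \in msupp p)) => hm.
  rewrite -big_filter (_ : [seq _ <- _ | _] = if Q m then [:: m] else [::]).
    by case: (Q m); rewrite ?big_seq1 ?big_nil.
  transitivity [seq x <- [seq x <- msupp p | x == m] | Q x].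
    by rewrite -filter_predI; apply: eq_filter => x /=.
  by rewrite (filter_pred1_uniq (msupp_uniq p) hm) /=; case: (Q m).
rewrite big1_seq ?(memN_msupp_eq0 hm) ?if_same //.
Qed.

(** Degrees are integers because shifts may make them negative; only 0 is homogeneous of a negative
    degree. *)
Definition hdeg t p : Prop := forall m, p@_m != 0 -> (mdeg m)%:Z = t.

Lemma in_degreeP t p : in_degree t p <-> hdeg t p.
Proof.
case: t => d /=; split.
- by move=> /dhomogP h m; rewrite -mcoeff_msupp => /h ->.
- by move=> h; apply/dhomogP => m; rewrite mcoeff_msupp => /h [].
- by move=> -> m; rewrite mcoeff0 eqxx.
- by move=> h; apply/mpolyP => m; rewrite mcoeff0; apply/eqP/negPn/negP => /h.
Qed.

Lemma hdeg0 t : hdeg t 0. Proof. by move=> m; rewrite mcoeff0 eqxx. Qed.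

Lemma hdegD t p q : hdeg t p -> hdeg t q -> hdeg t (p + q).
Proof.
move=> hp hq m; rewrite mcoeffD; case: (eqVneq p@_m 0) => [->|/hp //].
by rewrite add0r => /hq.
Qed.

Lemma hdegN t p : hdeg t p -> hdeg t (- p).
Proof. by move=> hp m; rewrite mcoeffN oppr_eq0 => /hp. Qed.

Lemma hdegM t1 t2 p q : hdeg t1 p -> hdeg t2 q -> hdeg (t1 + t2) (p * q).
Proof.
move=> hp hq m /mcoeffM_neq0 [m1 [m2 [-> /hp <- /hq <-]]].
by rewrite mdegD PoszD.
Qed.

Lemma hdegC a : hdeg 0 (a%:MP : R).
Proof.
move=> m; rewrite mcoeffC; case: (eqVneq m 0%MM) => [->|]; rewrite ?mdeg0 //.
by rewrite mulr0 eqxx.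
Qed.

Lemma hdeg0_const p : hdeg 0 p -> p = (p@_0%MM)%:MP.
Proof.
move=> hp; apply/mpolyP => m; rewrite mcoeffC.
have [->|hm] := eqVneq m 0%MM; first by rewrite mulr1.
by rewrite mulr0; apply/eqP/negPn/negP => /hp /eqP; rewrite eqz_nat mdeg_eq0 (negbTE hm).
Qed.

Lemma hdegCM t a p : hdeg t p -> hdeg t (a%:MP * p).
Proof. by move=> h; rewrite -[t]add0r; apply: hdegM => //; apply: hdegC. Qed.

Lemma hdegX m : hdeg (mdeg m) ('X_[m] : R).
Proof. by move=> m'; rewrite mcoeffX; case: (eqVneq m m') => [->|]; rewrite ?eqxx. Qed.

Lemma hdeg_sum (J : Type) (s : seq J) (Q : pred J) (f : J -> R) t :
  (forall j, hdeg t (f j)) -> hdeg t (\sum_(j <- s | Q j) f j).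
Proof. by move=> h; elim/big_ind: _ => //; [exact: hdeg0|exact: hdegD]. Qed.

Lemma hdeg_neq t p m : hdeg t p -> (mdeg m)%:Z != t -> p@_m = 0.
Proof. by move=> h; case: (eqVneq p@_m 0) => // /h ->; rewrite eqxx. Qed.

Definition hcomp t p : R := mfilter (fun m => (mdeg m)%:Z == t) p.

Lemma mcoeff_hcomp t p m :
  (hcomp t p)@_m = if (mdeg m)%:Z == t then p@_m else 0.
Proof. exact: mcoeff_filter. Qed.

Lemma hcompD t : {morph hcomp t : p q / p + q}.
Proof.
by move=> p q; apply/mpolyP => m; rewrite !(mcoeff_hcomp, mcoeffD); case: eqP; rewrite ?addr0.
Qed.

Lemma hcompB t : {morph hcomp t : p q / p - q}.
Proof.
by move=> p q; apply/mpolyP => m; rewrite !(mcoeff_hcomp, mcoeffB); case: eqP; rewrite ?subr0.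
Qed.

Lemma hcomp0 t : hcomp t 0 = 0.
Proof. by apply/mpolyP => m; rewrite mcoeff_hcomp mcoeff0 if_same. Qed.

Lemma hcomp_sum (J : Type) (s : seq J) (Q : pred J) (f : J -> R) t :
  hcomp t (\sum_(j <- s | Q j) f j) = \sum_(j <- s | Q j) hcomp t (f j).
Proof. by apply: (big_morph (hcomp t) (hcompD t) (hcomp0 t)). Qed.

Lemma hdeg_hcomp t p : hdeg t (hcomp t p).
Proof. by move=> m; rewrite mcoeff_hcomp; case: ifP => [/eqP//|]; rewrite eqxx. Qed.

Lemma hcomp_id t p : hdeg t p -> hcomp t p = p.
Proof.
by move=> h; apply/mpolyP => m; rewrite mcoeff_hcomp; case: eqP => // /eqP /(hdeg_neq h) ->.
Qed.

(** The terms of c outside degree t - e contribute to c * g only in degrees other than t. *)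
Lemma hcompM t e c g : hdeg e g -> hcomp t (c * g) = hcomp (t - e) c * g.
Proof.
move=> hg; pose c' := mfilter (fun m => (mdeg m)%:Z != t - e) c.
have {1}-> : c = hcomp (t - e) c + c'.
  apply/mpolyP => m; rewrite mcoeffD mcoeff_hcomp mcoeff_filter.
  by case: eqP; rewrite ?addr0 ?add0r.
rewrite mulrDl hcompD hcomp_id; last first.
  by rewrite -{1}[t](subrK e); apply: hdegM => //; apply: hdeg_hcomp.
rewrite (_ : hcomp t _ = 0) ?addr0 //; apply/mpolyP => m.
rewrite mcoeff_hcomp mcoeff0; case: eqP => // hm.
apply/eqP/negPn/negP => /mcoeffM_neq0 [m1 [m2 [em]]].
rewrite mcoeff_filter; case: ifP; last by rewrite eqxx.
move=> /eqP h1 _ /hg h2; apply: h1; rewrite -hm -h2 em mdegD PoszD; lia.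
Qed.

End Support.

(** * Ideals generated by the last variables *)

Section LastVariables.

Variables (n : nat) (K : fieldType).
Local Notation R := {mpoly K[n]}.
Implicit Types (p q c w : R) (m : 'X_{1..n}) (t : int) (r : nat).

Definition in_last r m : bool := [exists k : 'I_n, (n - r <= k)%N && (0 < m k)%N].

(* The ideal generated by the last r variables. *)
Definition last_ideal r p : Prop := forall m, p@_m != 0 -> in_last r m.

Lemma in_lastP r m :
  reflect (exists k : 'I_n, (n - r <= k)%N /\ (0 < m k)%N) (in_last r m).
Proof. by apply: (iffP existsP) => -[k /andP]; exists k. Qed.

Lemma in_lastDl r m1 m2 : in_last r m1 -> in_last r (m1 + m2)%MM.
Proof.
by move=> /in_lastP [k [h1 h2]]; apply/in_lastP; exists k; rewrite mnmDE; split=> //; lia.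
Qed.

Lemma in_lastDr r m1 m2 : in_last r m2 -> in_last r (m1 + m2)%MM.
Proof. by rewrite addmC; apply: in_lastDl. Qed.

Lemma in_last0 m : in_last 0 m = false.
Proof. by apply/in_lastP => -[k [h _]]; have := ltn_ord k; lia. Qed.

Lemma in_lastn m : in_last n m = (m != 0%MM).
Proof.
apply/in_lastP/idP => [[k [_ h]]|h].
  by apply/eqP => e; rewrite e mnm0E in h.
have : [exists k, m k != 0%N].
  apply: contraR h; rewrite negb_exists => /forallP h.
  by apply/eqP/mnmP => i; rewrite mnm0E; apply/eqP/negPn.
by move=> /existsP [k hk]; exists k; rewrite subnn; lia.
Qed.

Lemma last_ideal0 r : last_ideal r 0.
Proof. by move=> m; rewrite mcoeff0 eqxx. Qed.

Lemma last_idealD r p q : last_ideal r p -> last_ideal r q -> last_ideal r (p + q).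
Proof.
move=> hp hq m; rewrite mcoeffD; case: (eqVneq p@_m 0) => [->|/hp //].
by rewrite add0r => /hq.
Qed.

Lemma last_idealM r c p : last_ideal r p -> last_ideal r (c * p).
Proof. by move=> h m /mcoeffM_neq0 [m1 [m2 [-> _ /h]]]; apply: in_lastDr. Qed.

Lemma last_idealMr r c p : last_ideal r p -> last_ideal r (p * c).
Proof. by rewrite mulrC; apply: last_idealM. Qed.

Lemma last_idealN r p : last_ideal r p -> last_ideal r (- p).
Proof. by move=> h; rewrite -mulN1r; apply: last_idealM. Qed.

Lemma last_ideal_sum r (J : Type) (s : seq J) (Q : pred J) (f : J -> R) :
  (forall j, last_ideal r (f j)) -> last_ideal r (\sum_(j <- s | Q j) f j).
Proof. by move=> h; elim/big_ind: _ => //; [exact: last_ideal0|exact: last_idealD]. Qed.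

Lemma last_ideal_hcomp r t p : last_ideal r p -> last_ideal r (hcomp t p).
Proof. by move=> h m; rewrite mcoeff_hcomp; case: ifP => _ => [/h//|]; rewrite eqxx. Qed.

Lemma last_ideal_zero p : last_ideal 0 p -> p = 0.
Proof.
move=> h; apply/mpolyP => m; rewrite mcoeff0; apply/eqP/negPn/negP => /h.
by rewrite in_last0.
Qed.

Lemma last_ideal_all p : last_ideal n p <-> p@_0%MM = 0.
Proof.
split=> [h|h m]; first by apply/eqP/negPn/negP => /h; rewrite in_lastn eqxx.
by rewrite in_lastn; apply: contra => /eqP ->; rewrite h.
Qed.

(** Counted from 1 this is x_{n-r}, the variable that [chain] adds in step r + 1. *)
Definition next_var r : R := xvar n K (n - r.+1).

Section Step.

Variables (r : nat) (hr : (r < n)%N).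

Lemma next_index_proof : (n - r.+1 < n)%N. Proof. lia. Qed.
Definition next_index : 'I_n := Ordinal next_index_proof.
Local Notation y := next_index.

Lemma next_varE : next_var r = 'X_y.
Proof.
rewrite /next_var /xvar; case: insubP => [a _ ha|]; last by have := next_index_proof; lia.
by congr 'X_[U_(_)]; apply/val_inj.
Qed.

Lemma in_lastS m : in_last r.+1 m = (0 < m y)%N || in_last r m.
Proof.
apply/in_lastP/orP => [[k [h1 h2]]|[h|/in_lastP [k [h1 h2]]]].
- case: (eqVneq k y) => [<-|ne]; [by left|right].
  apply/in_lastP; exists k; split=> //.
  have : (k : nat) <> (n - r.+1)%N by move=> e; case/eqP: ne; apply/val_inj.
  lia.
- by exists y; split=> //=; lia.
- by exists k; split=> //; lia.
Qed.

Lemma last_idealS p : last_ideal r p -> last_ideal r.+1 p.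
Proof. by move=> h m /h; rewrite in_lastS => ->; rewrite orbT. Qed.

Lemma hdeg_next_var : hdeg 1 (next_var r).
Proof. by rewrite next_varE -[1]/(1%N%:Z) -(mdeg1 y); apply: hdegX. Qed.

Lemma last_ideal_next_var : last_ideal r.+1 (next_var r).
Proof.
rewrite next_varE => m; rewrite mcoeffX; case: (_ =P m) => [<-|]; last by rewrite eqxx.
by rewrite in_lastS mnm1E eqxx.
Qed.

(** The next variable is not among the last r, so multiplying a monomial by it does not affect
    [in_last r]: it is a nonzerodivisor modulo P_r. *)
Lemma last_ideal_reg w : last_ideal r (next_var r * w) -> last_ideal r w.
Proof.
rewrite next_varE => h m hm.
have /h/in_lastP[k [h1 h2]] : ('X_y * w)@_(U_(y) + m)%MM != 0 by rewrite mcoeffMXl.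
apply/in_lastP; exists k; split=> //; move: h2; rewrite mnmDE mnm1E.
case: eqP => // e; move: h1; rewrite -e /=; lia.
Qed.

(** Take for w the terms of p divisible by the next variable, divided by it; every other term
    involves one of the last r variables. *)
Lemma last_ideal_decomp p : last_ideal r.+1 p ->
  exists w, last_ideal r (p - next_var r * w) /\
            forall t, hdeg t p -> hdeg (t - 1) w.
Proof.
move=> hp; pose w := \sum_(m <- msupp p | (0 < m y)%N) p@_m *: 'X_[(m - U_(y))%MM].
have e : next_var r * w = mfilter (fun m => (0 < m y)%N) p.
  rewrite next_varE mulr_sumr; apply: eq_bigr => m hm.
  by rewrite -scalerAr -mpolyXD addmC submK // lep1mP; lia.
exists w; split=> [m|t hpt m].
  rewrite mcoeffB e mcoeff_filter; case: ifP => hm; first by rewrite subrr eqxx.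
  by rewrite subr0 => /hp; rewrite in_lastS hm.
have <- := mcoeffMXl w U_(y)%MM m; rewrite -[X in X * w]next_varE e mcoeff_filter.
case: ifP => _; last by rewrite eqxx.
by move=> /hpt <-; rewrite mdegD mdeg1 PoszD addrAC subrr add0r.
Qed.

End Step.
End LastVariables.

(** * Complexes of free modules modulo the last variables *)

Section Chain.

Variables (n : nat) (K : fieldType).
Local Notation R := {mpoly K[n]}.
Implicit Types (I J : R -> Prop) (p q c w : R).

Lemma ideal_gen_ideal (S : R -> Prop) : is_ideal (ideal_gen S).
Proof.
split.
- by exists 0%N, (fun=> 0), (fun=> 0); split=> [[]|] //; rewrite big_ord0.
- move=> _ _ [k1 [c1 [g1 [h1 ->]]]] [k2 [c2 [g2 [h2 ->]]]].
  exists (k1 + k2)%N, (fun a => match split a with inl b => c1 b | inr b => c2 b end),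
    (fun a => match split a with inl b => g1 b | inr b => g2 b end).
  split=> [a|]; first by case: (split a).
  rewrite big_split_ord /=; congr (_ + _); apply: eq_bigr => a _.
    by rewrite (unsplitK (inl a)).
  by rewrite (unsplitK (inr a)).
- move=> c _ [k [c1 [g1 [h1 ->]]]]; exists k, (fun a => c * c1 a), g1.
  by split=> //; rewrite mulr_sumr; apply: eq_bigr => a _; rewrite mulrA.
Qed.

Lemma mem_ideal_gen (S : R -> Prop) p : S p -> ideal_gen S p.
Proof.
by exists 1%N, (fun=> 1), (fun=> p); rewrite big_ord1 mul1r.
Qed.

Lemma principalP x p : principal x p <-> exists c, p = c * x.
Proof.
split=> [[k [c [g [hg ->]]]]|[c ->]].
  by exists (\sum_a c a); rewrite mulr_suml; apply: eq_bigr => a _; rewrite hg.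
by case: (ideal_gen_ideal (fun p => p = x)) => _ _; apply; apply: mem_ideal_gen.
Qed.

Section Ideal.

Variables (I : R -> Prop) (hI : is_ideal I).

Lemma idealN p : I p -> I (- p).
Proof. by case: hI => _ _ hM hp; rewrite -mulN1r; apply: hM. Qed.

Lemma idealB p q : I p -> I q -> I (p - q).
Proof. by case: (hI) => _ hD _ hp /idealN; apply: hD. Qed.

Lemma ideal_subr p q : I (p - q) -> I q -> I p.
Proof. by case: (hI) => _ hD _ hp hq; rewrite -(subrK q p); apply: hD. Qed.

Lemma ideal_unit p : I p -> hdeg 0 p -> p@_0%MM != 0 -> I 1.
Proof.
move=> hp dp p0; rewrite -[1](_ : (p@_0%MM)^-1%:MP * p = 1).
  by case: hI => _ _; apply.
by rewrite {2}(hdeg0_const dp) -mpolyCM mulVf // mpolyC1.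
Qed.

Lemma ideal_sum (T : Type) (s : seq T) (Q : pred T) (f : T -> R) :
  (forall j, I (f j)) -> I (\sum_(j <- s | Q j) f j).
Proof. by case: (hI) => h0 hD _ h; elim/big_ind: _. Qed.

Lemma colon_principal x p : colon I (principal x) p <-> I (p * x).
Proof.
split=> [h|h q /principalP [c ->]]; first by apply: h; apply/principalP; exists 1; rewrite mul1r.
by case: hI => _ _ hM; rewrite mulrCA; apply: hM.
Qed.

Lemma colon_ideal x : is_ideal (colon I (principal x)).
Proof.
case: (hI) => h0 hD hM; split.
- by apply/colon_principal; rewrite mul0r.
- by move=> p q /colon_principal hp /colon_principal hq; apply/colon_principal; rewrite mulrDl; apply: hD.
- by move=> c p /colon_principal hp; apply/colon_principal; rewrite -mulrA; apply: hM.
Qed.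

(** I_r = I + P_r: [last_ideal_decomp] peels off one variable per step. *)
Lemma chainP r p : (r <= n)%N ->
  chain I r p <-> exists2 a, I a & last_ideal r (p - a).
Proof.
elim: r p => [|r IH] p hr /=.
  split=> [hp|[a ha /last_ideal_zero /eqP]]; last by rewrite subr_eq0 => /eqP ->.
  by exists p => //; rewrite subrr; apply: last_ideal0.
have hr' : (r < n)%N by [].
split=> [[a [b [/(IH _ (ltnW hr)) [a' ha' la'] /principalP [c ->] ->]]]|[a ha]].
  exists a' => //; rewrite addrAC; apply: last_idealD; first exact: last_idealS.
  exact/last_idealM/last_ideal_next_var.
move=> /(last_ideal_decomp hr') [w [hw _]].
exists (p - w * next_var n K r), (w * next_var n K r); split; last by rewrite subrK.
  by apply/(IH _ (ltnW hr)); exists a => //; rewrite addrAC [w * _]mulrC.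
by apply/principalP; exists w.
Qed.

Lemma chain_ideal r : (r <= n)%N -> is_ideal (chain I r).
Proof.
move=> hr; case: (hI) => h0 hD hM; split.
- by apply/(chainP _ hr); exists 0; rewrite ?subrr //; apply: last_ideal0.
- move=> p q /(chainP _ hr) [a ha la] /(chainP _ hr) [b hb lb].
  apply/(chainP _ hr); exists (a + b); first exact: hD.
  by rewrite opprD addrACA; apply: last_idealD.
- move=> c p /(chainP _ hr) [a ha la]; apply/(chainP _ hr).
  by exists (c * a); [exact: hM|rewrite -mulrBr; apply: last_idealM].
Qed.

Lemma last_ideal_chain r p : (r <= n)%N -> last_ideal r p -> chain I r p.
Proof.
by move=> hr hp; apply/(chainP _ hr); exists 0; rewrite ?subr0 //; case: hI.
Qed.

End Ideal.
End Chain.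

(** * Dimensions of quotients and linear correspondences *)

Section QuotientDimension.

Variables (n : nat) (K : fieldType).
Local Notation R := {mpoly K[n]}.

(* dim_K Z / (B \cap Z) = k, where K acts through the constant polynomials. *)
Definition quot_dim (V : lmodType R) (Z B : V -> Prop) (k : nat) : Prop :=
  exists v : 'I_k -> V,
    [/\ forall a, Z (v a),
        forall c : 'I_k -> K, B (\sum_a (c a)%:MP *: v a) -> forall a, c a = 0 &
        forall z, Z z -> exists c : 'I_k -> K, B (z - \sum_a (c a)%:MP *: v a)].

Lemma quot_dim0P (V : lmodType R) (Z B : V -> Prop) k : quot_dim Z B k ->
  (k = 0%N <-> forall z, Z z -> B z).
Proof.
move=> [v [hZ hfree hspan]]; split=> [k0 z /hspan [c]|h].
  by subst k; rewrite big_ord0 subr0.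
case: k v hZ hfree {hspan} => // k v hZ hfree.
have hb : B (\sum_a ((a == ord0)%:R : K)%:MP *: v a).
  rewrite (bigD1 ord0) //= big1 => [|a /negbTE ->]; last by rewrite mpolyC0 scale0r.
  by rewrite addr0 mpolyC1 scale1r; apply/h.
by have /eqP := hfree _ hb ord0; rewrite oner_eq0.
Qed.

Lemma quot_dim_ext (V : lmodType R) (Z Z' B B' : V -> Prop) k :
  (forall z, Z z <-> Z' z) -> (forall z, B z <-> B' z) ->
  quot_dim Z B k -> quot_dim Z' B' k.
Proof.
move=> hZ hB [v [h1 h2 h3]]; exists v; split=> [a|c /hB/h2 //|z /hZ/h3 [c hc]].
  exact/hZ.
by exists c; apply/hB.
Qed.

(** A linear correspondence that is total on both sides and respects B induces an isomorphism of
    quotients. A relation suits the connecting homomorphism, whose values depend on choices. *)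
Lemma quot_dim_transfer (V W : lmodType R) (ZV BV : V -> Prop) (ZW BW : W -> Prop)
  (delta : V -> W -> Prop) k :
  delta 0 0 ->
  (forall v v' w w', delta v w -> delta v' w' -> delta (v + v') (w + w')) ->
  (forall (c : K) v w, delta v w -> delta (c%:MP *: v) (c%:MP *: w)) ->
  (forall v, ZV v -> exists2 w, ZW w & delta v w) ->
  (forall w, ZW w -> exists2 v, ZV v & delta v w) ->
  (forall v w, delta v w -> (BV v <-> BW w)) ->
  quot_dim ZW BW k -> quot_dim ZV BV k.
Proof.
move=> d0 dD dZ dl dr dB [w [hZ hfree hspan]].
have /fin_all_exists2 [v hv hvw] : forall a, exists2 v, ZV v & delta v (w a) by move=> a; apply: dr.
have dS (c : 'I_k -> K) : delta (\sum_a (c a)%:MP *: v a) (\sum_a (c a)%:MP *: w a).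
  by elim/big_ind2: _ => // *; [exact: dD|exact: dZ].
exists v; split=> // [c /(dB _ _ (dS c)) /hfree //|z /dl [x hx hzx]].
have [c hc] := hspan _ hx; exists c.
apply/(dB _ (x - \sum_a (c a)%:MP *: w a)) => //; apply: dD => //.
rewrite -[X in delta X]scaleN1r -[X in delta _ X]scaleN1r -mpolyC1 -mpolyCN.
exact: dZ.
Qed.

End QuotientDimension.

(** * The long exact sequence of multiplication by the next variable *)

Section Complex.

Variables (n : nat) (K : fieldType).
Local Notation R := {mpoly K[n]}.
Variables (rk : nat -> nat) (dg : forall i, 'I_(rk i) -> int)
  (dd : forall i, 'M[R]_(rk i.+1, rk i)).
Arguments dg : clear implicits.
Hypotheses (dd_hom : forall i a b, hdeg (dg i.+1 a - dg i b) (dd i a b))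
  (ddK : forall i, dd i.+1 *m dd i = 0)
  (dd_exact : forall i (u : 'rV_(rk i.+1)), u *m dd i = 0 -> exists v, u = v *m dd i.+1).

Local Notation y r := (next_var n K r).

(** Entry a lies in the summand R(- dg i a), which accounts for the shift. *)
Definition row_deg i (d : int) (u : 'rV[R]_(rk i)) : Prop :=
  forall a, hdeg (d - dg i a) (u 0 a).

Definition row_last r m (u : 'rV[R]_m) : Prop := forall a, last_ideal r (u 0 a).

(* [cyc r i d] and [bd r i.+1] are the cycles of degree d and the boundaries of
   the complex modulo the last r variables in homological degree i.+1; note
   the shift of the index of [cyc]. *)
Definition bd r i (u : 'rV[R]_(rk i)) : Prop :=
  exists v, row_last r (u - v *m dd i).

Definition cyc r i d (u : 'rV[R]_(rk i.+1)) : Prop :=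
  row_deg d u /\ row_last r (u *m dd i).

(* The kernel of multiplication by the next variable on homology. *)
Definition mul_ker r i d (w : 'rV[R]_(rk i)) : Prop :=
  row_deg d w /\ bd r (y r *: w).

(* The graph of the connecting homomorphism. *)
Definition connect r i d (u : 'rV[R]_(rk i.+1)) (w : 'rV[R]_(rk i)) : Prop :=
  [/\ row_deg d u, row_deg (d - 1) w & row_last r (u *m dd i - y r *: w)].

Lemma row_degD i d (u v : 'rV_(rk i)) : row_deg d u -> row_deg d v -> row_deg d (u + v).
Proof. by move=> hu hv a; rewrite mxE; apply: hdegD. Qed.

Lemma row_degN i d (u : 'rV_(rk i)) : row_deg d u -> row_deg d (- u).
Proof. by move=> hu a; rewrite mxE; apply: hdegN. Qed.

Lemma row_degZ i d c (u : 'rV_(rk i)) : row_deg d u -> row_deg d (c%:MP *: u).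
Proof. by move=> hu a; rewrite mxE; apply: hdegCM. Qed.

Lemma row_degM i d (u : 'rV_(rk i.+1)) : row_deg d u -> row_deg d (u *m dd i).
Proof.
move=> hu a; rewrite mxE; apply: hdeg_sum => b.
by rewrite -(subrKA (dg i.+1 b)); apply: hdegM.
Qed.

Lemma row_lastD r m (u v : 'rV[R]_m) : row_last r u -> row_last r v -> row_last r (u + v).
Proof. by move=> hu hv a; rewrite mxE; apply: last_idealD. Qed.

Lemma row_lastN r m (u : 'rV[R]_m) : row_last r u -> row_last r (- u).
Proof. by move=> hu a; rewrite mxE; apply: last_idealN. Qed.

Lemma row_lastZ r m c (u : 'rV[R]_m) : row_last r u -> row_last r (c *: u).
Proof. by move=> hu a; rewrite mxE; apply: last_idealM. Qed.

Lemma row_lastM r m k (u : 'rV[R]_m) (A : 'M_(m, k)) : row_last r u -> row_last r (u *m A).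
Proof. by move=> hu a; rewrite mxE; apply: last_ideal_sum => b; apply: last_idealMr. Qed.

Lemma row_last0 r m : row_last r (0 : 'rV[R]_m).
Proof. by move=> a; rewrite mxE; apply: last_ideal0. Qed.

(** Cut v down to the right homogeneous components: the differential is homogeneous and P_r is a
    monomial ideal. *)
Lemma bd_homog r i d (u : 'rV_(rk i)) : row_deg d u -> bd r u ->
  exists2 v, row_deg d v & row_last r (u - v *m dd i).
Proof.
move=> hu [v hv]; exists (\row_a hcomp (d - dg i.+1 a) (v 0 a)).
  by move=> a; rewrite mxE; apply: hdeg_hcomp.
move=> a; have := last_ideal_hcomp (t := d - dg i a) (hv a).
rewrite !mxE hcompB (hcomp_id (hu a)) hcomp_sum.
congr (last_ideal _ (_ - _)); apply: eq_bigr => b _; rewrite mxE.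
by rewrite (hcompM _ _ (@dd_hom _ b a)) opprB addrA subrK.
Qed.

Lemma connect_cyc r i d (u : 'rV_(rk i.+1)) : (r < n)%N -> cyc r.+1 d u ->
  exists w, connect r d u w.
Proof.
move=> hr [hu hc].
have /fin_all_exists [w hw] a := last_ideal_decomp hr (hc a).
exists (\row_a w a); split=> // a; have [h1 h2] := hw a; rewrite !mxE.
  by rewrite addrAC; apply/h2/row_degM.
by move: h1; rewrite mxE.
Qed.

Lemma connect_ker r i d (u : 'rV_(rk i.+1)) w :
  connect r d u w -> mul_ker r (d - 1) w.
Proof.
move=> [hu hw h]; split=> //; exists u; rewrite -opprB; exact: row_lastN.
Qed.

(** A homogeneous u that bounds y w modulo P_r is sent to w by the connecting homomorphism. *)
Lemma ker_connect r i d (w : 'rV_(rk i)) : (r < n)%N -> mul_ker r (d - 1) w ->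
  exists u, connect r d u w.
Proof.
move=> hr [hw hb]; have hy : row_deg d (y r *: w).
  move=> a; rewrite mxE (_ : d - dg i a = 1 + (d - 1 - dg i a)); last by lia.
  by apply: hdegM => //; apply: hdeg_next_var.
have [u hu h] := bd_homog hy hb; exists u; split=> //.
by rewrite -opprB; apply: row_lastN.
Qed.

Lemma cyc_connect r i d (u : 'rV_(rk i.+1)) w : (r < n)%N ->
  connect r d u w -> cyc r.+1 d u.
Proof.
move=> hr [hu hw h]; split=> // a; rewrite -(subrK (y r * w 0 a) (_ 0 a)).
apply: last_idealD; first by apply: last_idealS => //; have := h a; rewrite !mxE.
exact/last_idealMr/last_ideal_next_var.
Qed.

(** Write u = v d + y z modulo P_r, with d the differential. Applying d gives y (w - z d) = 0 modulo
    P_r, and y is a nonzerodivisor there. *)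
Lemma connect_bd_l r i d (u : 'rV_(rk i.+1)) w : (r < n)%N ->
  connect r d u w -> bd r.+1 u -> bd r w.
Proof.
move=> hr [hu hw h] [v hv].
have /fin_all_exists [z hz] a := last_ideal_decomp hr (hv a).
exists (\row_a z a) => a; apply: (last_ideal_reg hr).
have -> : y r * (w - (\row_a z a) *m dd i) 0 a =
  - (u *m dd i - y r *: w) 0 a + ((u - v *m dd i.+1 - y r *: (\row_a z a)) *m dd i) 0 a.
  rewrite !mulmxBl -mulmxA ddK mulmx0 subr0 -scalemxAl.
  move: (u *m _) (_ *m _) => A B; rewrite !mxE mulrBr; ring.
apply: last_idealD; first exact: last_idealN.
by apply: row_lastM => b; have [] := hz b; rewrite !mxE.
Qed.

(** If w = z d modulo P_r, then u - y z is a cycle modulo P_r, hence a boundary by the assumed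
    vanishing, and y z disappears modulo P_{r+1}. *)
Lemma connect_bd_r r i d (u : 'rV_(rk i.+1)) w : (r < n)%N ->
  (forall u : 'rV_(rk i.+1), cyc r d u -> bd r u) ->
  connect r d u w -> bd r w -> bd r.+1 u.
Proof.
move=> hr hvan [hu hw h] hb; have [z hz1 hz] := bd_homog hw hb.
have [v hv] : bd r (u - y r *: z).
  apply: hvan; split.
    apply: row_degD => //; apply: row_degN => a; rewrite mxE.
    rewrite (_ : d - dg i.+1 a = 1 + (d - 1 - dg i.+1 a)); last by lia.
    by apply: hdegM => //; apply: hdeg_next_var.
  rewrite mulmxBl -scalemxAl -(subrKA (y r *: w)) -scalerBr.
  by apply: row_lastD => //; apply: row_lastZ.
exists v; rewrite -(subrK (y r *: z) u) addrAC; apply: row_lastD => [a|a].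
  by apply: last_idealS => //; apply: hv.
by rewrite mxE; apply/last_idealMr/last_ideal_next_var.
Qed.

(** [mul_ker] does not ask for cycles: y (w d) vanishes modulo P_r because y w is a boundary, and y
    can be cancelled. *)
Lemma mul_ker_cyc r i d (w : 'rV_(rk i.+1)) : (r < n)%N -> mul_ker r d w -> cyc r d w.
Proof.
move=> hr [hw [v hv]]; split=> // a; apply: (last_ideal_reg hr).
have -> : y r * (w *m dd i) 0 a = ((y r *: w - v *m dd i.+1) *m dd i) 0 a.
  by rewrite mulmxBl -mulmxA ddK mulmx0 subr0 -scalemxAl [RHS]mxE.
exact: row_lastM.
Qed.

Lemma cycZ r i d (w : 'rV_(rk i.+1)) : (r < n)%N -> cyc r d w -> cyc r (d + 1) (y r *: w).
Proof.
move=> hr [hw h]; split=> [a|].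
  rewrite mxE (_ : d + 1 - dg i.+1 a = 1 + (d - dg i.+1 a)); last by lia.
  by apply: hdegM => //; apply: hdeg_next_var.
by rewrite -scalemxAl; apply: row_lastZ.
Qed.

(* The homology modulo the last r variables vanishes in homological degree i.+1
   and degree i + j.  For a resolution of R / I and r = n this says that
   beta_{i,i+j}(I) = 0; the index j of [ker_van] is shifted in the same way. *)
Definition tor_van r i j : Prop :=
  forall u : 'rV_(rk i.+1), cyc r (i + j)%N u -> bd r u.

(** The degree drops by one because the connecting homomorphism divides by a variable. For i = 0 the
    condition concerns the annihilator in degree j - 1. *)
Definition ker_van r i j : Prop :=
  forall w : 'rV_(rk i), mul_ker r ((i + j)%N%:Z - 1) w -> bd r w.

Lemma tor_van0 i j : tor_van 0 i j.
Proof.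
move=> u [_ h]; have [|v ->] := @dd_exact i u.
  by apply/rowP => a; rewrite [RHS]mxE; apply: last_ideal_zero.
by exists v; rewrite subrr; apply: row_last0.
Qed.

Lemma tor_vanS r i j : (r < n)%N -> tor_van r i j -> ker_van r i j -> tor_van r.+1 i j.
Proof.
move=> hr hT hK u /(connect_cyc hr) [w hw].
exact/(connect_bd_r hr hT hw)/hK/connect_ker/hw.
Qed.

Lemma ker_vanS r i j : (r < n)%N -> tor_van r.+1 i j -> ker_van r i j.
Proof.
move=> hr hT w /(ker_connect hr) [u hu].
exact/(connect_bd_l hr hu)/hT/(cyc_connect hr hu).
Qed.

(** The kernel in homological degree i + 1 has degree (i + 1 + j) - 1 = i + j here, so it lies in
    the homology that [tor_van r i j] controls. *)
Lemma ker_van_tor r i j : (r < n)%N -> tor_van r i j -> ker_van r i.+1 j.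
Proof.
move=> hr hT w; rewrite addSn intS addrAC subrr add0r => /(mul_ker_cyc hr).
exact: hT.
Qed.

(** If the homology vanishes one degree higher, every class is killed by y and so lies in the
    kernel. *)
Lemma tor_van_ker r i j : (r < n)%N -> ker_van r i.+1 j -> tor_van r i j.+1 -> tor_van r i j.
Proof.
move=> hr hK hT u hu; apply: hK; rewrite addSn intS addrAC subrr add0r.
split; first by case: hu.
by apply: hT; rewrite addnS -addn1 PoszD; apply: cycZ.
Qed.

(** The connecting homomorphism is an isomorphism when the homology modulo P_r vanishes. *)
Lemma quot_dim_connect r i j k : (r < n)%N -> tor_van r i j ->
  quot_dim (mul_ker r ((i + j)%N%:Z - 1)) (@bd r i) k ->
  quot_dim (@cyc r.+1 i (i + j)%N) (@bd r.+1 i.+1) k.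
Proof.
move=> hr hT; apply: (quot_dim_transfer (delta := connect r (i + j)%N)).
- split=> [a|a|]; rewrite ?mxE; try exact: hdeg0.
  by rewrite mul0mx scaler0 subr0; apply: row_last0.
- move=> u u' w w' [h1 h2 h3] [h1' h2' h3']; split; try exact: row_degD.
  by rewrite mulmxDl scalerDr opprD addrACA; apply: row_lastD.
- move=> c u w [h1 h2 h3]; split; try exact: row_degZ.
  by rewrite -scalemxAl scalerA mulrC -scalerA -scalerBr; apply: row_lastZ.
- by move=> u /(connect_cyc hr) [w hw]; exists w => //; apply: connect_ker hw.
- by move=> w /(ker_connect hr) [u hu]; exists u => //; apply: cyc_connect hu.
- by move=> u w huw; split; [apply: connect_bd_l huw|apply: connect_bd_r huw].
Qed.

(** Multiplication by y lands in a vanishing group, so its kernel is the whole homology. *)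
Lemma quot_dim_mul_ker r i j k : (r < n)%N -> tor_van r i j.+1 ->
  quot_dim (@cyc r i (i + j)%N) (@bd r i.+1) k ->
  quot_dim (mul_ker r ((i.+1 + j)%N%:Z - 1)) (@bd r i.+1) k.
Proof.
move=> hr hT; apply: quot_dim_ext => // u; rewrite addSn intS addrAC subrr add0r.
split=> [hu|]; last exact: mul_ker_cyc.
split; first by case: hu.
by apply: hT; rewrite addnS -addn1 PoszD; apply: cycZ.
Qed.

(** Induction on r with [tor_vanS]. The kernel for i = 0 is a hypothesis; for i + 1 it lies in the
    homology for i with one variable fewer, whence the bound s + i < r. *)
Lemma tor_van_of_ker0 r i j : (r <= n)%N ->
  (forall s, (s + i < r)%N -> ker_van s 0 j) -> tor_van r i j.
Proof.
elim: r i => [|r IH] i hr h; first exact: tor_van0.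
apply: tor_vanS => //; first by apply: IH => [|s hs]; [exact: ltnW|apply: h; lia].
case: i h => [|i] h; first by apply: h; lia.
by apply: ker_van_tor => //; apply: IH => [|s hs]; [exact: ltnW|apply: h; lia].
Qed.

Variables (D : nat).
Hypothesis ker0_large : forall s j, (s < n)%N -> (D <= j)%N -> ker_van s 0 j.

Lemma tor_van_large r i j : (r <= n)%N -> (D <= j)%N -> tor_van r i j.
Proof. by move=> hr hj; apply: tor_van_of_ker0 => // s hs; apply: ker0_large; lia. Qed.

(** Removes the variables from P_n one at a time. At each stage the kernels vanish by [ker_vanS], so
    a nonzero class would stay nonzero under all powers of y, against the vanishing in large
    degrees. *)
Lemma ker0_of_tor_van i0 j0 :
  (forall i j, (i0 <= i)%N -> (j0 <= j)%N -> tor_van n i j) ->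
  forall s j, (s + i0 < n)%N -> (j0 <= j)%N -> ker_van s 0 j.
Proof.
(* Each variable removed lowers the bound on i by one. *)
move=> h; have hT e : (e <= n)%N -> forall i j, (i0 <= i + e)%N -> (j0 <= j)%N ->
    tor_van (n - e) i j.
  elim: e => [|e IH] he i j hi hj; first by rewrite subn0; apply: h; rewrite -1?[i]addn0.
  have hr : (n - e.+1 < n)%N by lia.
  have hK j' : (j0 <= j')%N -> ker_van (n - e.+1) i.+1 j'.
    move=> hj'; apply: ker_vanS => //; rewrite subnSK //; apply: IH => //; lia.
  have [hD|hD] := leqP D j; first by apply: tor_van_large => //; lia.
  have : tor_van (n - e.+1) i (j + (D - j)) by apply: tor_van_large; lia.
  (* Descend to j from a degree j + (D - j) >= D, where the homology is known to vanish. *)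
  elim: (D - j)%N => [|k IHk]; first by rewrite addn0.
  rewrite addnS => /(tor_van_ker hr (hK _ _)) hk; apply/IHk/hk; lia.
move=> s j hs hj; have hs' : (s < n)%N by lia.
apply: ker_vanS => //; rewrite (_ : s.+1 = n - (n - s.+1))%N; last by lia.
by apply: hT => //; lia.
Qed.

(** Two isomorphisms alternate, starting from the annihilator with r = n - i0 - 1: the connecting
    one raises r and the homological degree by one (vanishing from [h1]), and the new homology
    equals the kernel of the next variable (vanishing from [h2]). *)
Lemma quot_dim_top i0 j0 k : (i0 < n)%N ->
  (forall s, (s + i0.+1 < n)%N -> ker_van s 0 j0) ->
  (forall s, (s + i0 < n)%N -> ker_van s 0 j0.+1) ->
  quot_dim (mul_ker (n - i0.+1) (j0%:Z - 1)) (@bd (n - i0.+1) 0) k ->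
  quot_dim (@cyc n i0 (i0 + j0)%N) (@bd n i0.+1) k.
Proof.
move=> hi h1 h2 hq.
have : forall e, (e <= i0)%N ->
    quot_dim (@cyc (n - i0 + e) e (e + j0)%N) (@bd (n - i0 + e) e.+1) k.
  elim=> [_|e IH he].
    rewrite addn0 -subnSK //; apply: quot_dim_connect => //; first by lia.
    by apply: tor_van_of_ker0 => [|s hs]; [lia|apply: h1; lia].
  rewrite addnS; apply: quot_dim_connect; first by lia.
    by apply: tor_van_of_ker0 => [|s hs]; [lia|apply: h1; lia].
  apply: quot_dim_mul_ker; [lia| |apply: IH; lia].
  by apply: tor_van_of_ker0 => [|s hs]; [lia|apply: h2; lia].
by move=> /(_ i0 (leqnn _)); rewrite subnK // ltnW.
Qed.

End Complex.

(** * Initial ideals *)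

Section Revlex.

Variable n : nat.
Implicit Types (a b c m : 'X_{1..n}) (r : nat) (d : int).

Lemma revlexP a b : mdeg a = mdeg b ->
  reflect (exists2 k : 'I_n, (b k < a k)%N & forall l : 'I_n, (k < l)%N -> a l = b l)
    (revlex_lt a b).
Proof.
move=> e; rewrite /revlex_lt e ltnn eqxx /=; apply: (iffP existsP).
  by move=> [k /andP [h /forallP hk]]; exists k => // l hl; apply/eqP/(implyP (hk l)).
move=> [k h hk]; exists k; rewrite h; apply/forallP => l; apply/implyP => hl.
exact/eqP/hk.
Qed.

Lemma revlex_mdeg a b : revlex_lt a b -> (mdeg a <= mdeg b)%N.
Proof. by case/orP => [/ltnW //|/andP [/eqP ->]]. Qed.

Lemma revlex_irr a : revlex_lt a a = false.
Proof. by apply/revlexP => // -[k]; rewrite ltnn. Qed.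

Lemma revlex_total a b : mdeg a = mdeg b -> a != b -> revlex_lt a b || revlex_lt b a.
Proof.
move=> e ne; have [k0 hk0] : exists k, a k != b k.
  apply/existsP; apply: contraR ne; rewrite negb_exists => /forallP h.
  by apply/eqP/mnmP => i; apply/eqP/negPn/h.
case: (arg_maxnP (P := fun k => a k != b k) (fun k : 'I_n => k : nat) hk0) => k hk hmax.
have hl (l : 'I_n) : (k < l)%N -> a l = b l.
  by move=> h; apply/eqP/negPn/negP => /hmax /=; lia.
case: (ltngtP (a k) (b k)) => h; last by rewrite h eqxx in hk.
  by apply/orP; right; apply/revlexP => //; exists k => // l /hl.
by apply/orP; left; apply/revlexP => //; exists k.
Qed.

Lemma revlex_trans a b c : revlex_lt a b -> revlex_lt b c -> revlex_lt a c.
Proof.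
move=> hab hbc; have := revlex_mdeg hab; have := revlex_mdeg hbc.
rewrite leq_eqVlt => /orP [/eqP e2|h2 h1]; last by apply/orP; left; lia.
rewrite leq_eqVlt => /orP [/eqP e1|h1]; last by apply/orP; left; lia.
have [k1 h1 g1] := revlexP e1 hab; have [k2 h2 g2] := revlexP e2 hbc.
apply/revlexP; first by rewrite e1.
have [h|h|/val_inj h] := ltngtP k1 k2.
- by exists k2 => [|l hl]; [rewrite g1|rewrite g1 ?g2 //; apply: ltn_trans hl].
- by exists k1 => [|l hl]; [rewrite -g2|rewrite g1 ?g2 //; apply: ltn_trans hl].
- by subst k2; exists k1 => [|l hl]; [apply: ltn_trans h1|rewrite g1 ?g2].
Qed.

Lemma revlex_add2l c a b : revlex_lt (c + a)%MM (c + b)%MM = revlex_lt a b.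
Proof.
rewrite /revlex_lt !mdegD ltn_add2l eqn_add2l; congr (_ || (_ && _)).
apply: eq_existsb => k; rewrite !mnmDE ltn_add2l; congr (_ && _).
by apply: eq_forallb => l; rewrite !mnmDE eqn_add2l.
Qed.

(** Were b smaller, then at the last index where the exponents differ b would have the larger one.
    That index is not among the last r, so a and b agree on the last r variables, which a involves
    and b does not. *)
Lemma revlex_in_last r a b : mdeg a = mdeg b -> in_last r a -> ~~ in_last r b ->
  revlex_lt a b.
Proof.
move=> e ha hb; have ne : a != b by apply: contraNneq hb => <-.
have /orP [//|/(revlexP (esym e)) [k hk hl]] := revlex_total e ne.
have /in_lastP [k0 [h1 h2]] := ha; case/negP: hb; apply/in_lastP.
have [h|h] := leqP k0 k; first by exists k; lia.
by exists k0; rewrite hl.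
Qed.

Definition monomials d : seq 'X_{1..n} :=
  [seq m <- [seq bmnm x | x <- enum {: 'X_{1..n < `|d|%N.+1}}] | (mdeg m)%:Z == d].

Lemma mem_monomials d m : (m \in monomials d) = ((mdeg m)%:Z == d).
Proof.
rewrite mem_filter; case: eqP => //= <-; apply/mapP.
by exists (BMultinom (ltnSn (mdeg m))) => //=; rewrite mem_enum.
Qed.

Lemma monomials_uniq d : uniq (monomials d).
Proof. by rewrite filter_uniq // map_inj_uniq ?enum_uniq //; apply: val_inj. Qed.

(** The position of m among the monomials of degree d; it allows maxima and inductions over natural
    numbers. *)
Definition revlex_rank d m := count (fun m' => revlex_lt m' m) (monomials d).

Lemma revlex_rank_lt d a b : (mdeg a)%:Z = d -> revlex_lt a b ->
  (revlex_rank d a < revlex_rank d b)%N.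
Proof.
move=> ha hab; have hm : a \in monomials d by rewrite mem_monomials ha.
have := count_predUI (fun m => revlex_lt m a) (pred1 a) (monomials d).
rewrite (count_uniq_mem _ (monomials_uniq d)) hm (@eq_count _ (predI _ _) pred0).
  rewrite count_pred0 addn0 addn1 /revlex_rank => <-.
  by apply: sub_count => m /= /orP [/revlex_trans|/eqP ->] //; apply.
by move=> m /=; case: eqP => [->|]; rewrite ?revlex_irr ?andbF.
Qed.

Lemma revlex_rankP d a b : (mdeg a)%:Z = d -> (mdeg b)%:Z = d ->
  (revlex_rank d a < revlex_rank d b)%N = revlex_lt a b.
Proof.
move=> ha hb; apply/idP/idP => [h|]; last exact: revlex_rank_lt.
have ne : a != b by apply: contraTneq h => ->; rewrite ltnn.
have /orP [//|/(revlex_rank_lt hb)] : revlex_lt a b || revlex_lt b a.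
  by apply: revlex_total ne; move: ha; rewrite -hb => -[].
by move=> h'; have := ltn_trans h h'; rewrite ltnn.
Qed.

Lemma revlex_rank_inj d a b : (mdeg a)%:Z = d -> (mdeg b)%:Z = d ->
  revlex_rank d a = revlex_rank d b -> a = b.
Proof.
move=> ha hb e; apply/eqP/negPn/negP => ne.
have : revlex_lt a b || revlex_lt b a.
  by apply: revlex_total ne; move: ha; rewrite -hb => -[].
by rewrite -!(revlex_rankP (d := d)) // e ltnn.
Qed.

End Revlex.

Section InitialMonomials.

Variables (n : nat) (K : fieldType).
Local Notation R := {mpoly K[n]}.
Implicit Types (I J L : R -> Prop) (p q c f g w : R) (m : 'X_{1..n}) (r : nat) (d : int).

Definition init_mon J m : Prop := exists2 f, J f & is_initial_monomial f m.

(** Closure under homogeneous components replaces homogeneous generators; [graded_ideal_hgraded]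
    connects the two. *)
Definition hgraded J : Prop := is_ideal J /\ forall d p, J p -> J (hcomp d p).

Lemma is_initial_rank d f m : hdeg d f -> is_initial_monomial f m ->
  forall m', m' \in msupp f -> m' != m -> (revlex_rank d m' < revlex_rank d m)%N.
Proof.
move=> hf [hm hi] m' hm' ne; apply: revlex_rank_lt; last exact: hi.
by apply: hf; rewrite -mcoeff_msupp.
Qed.

Lemma is_initialX m : is_initial_monomial ('X_[m] : R) m.
Proof. by split=> [|m']; rewrite msuppX mem_seq1 // => ->. Qed.

Lemma is_initialMX m' f m :
  is_initial_monomial f m -> is_initial_monomial ('X_[m'] * f) (m' + m)%MM.
Proof.
move=> [hm hi]; split; first by rewrite mcoeff_msupp mcoeffMXl -mcoeff_msupp.
move=> m1; rewrite mcoeff_msupp => /mcoeffM_neq0 [m2 [m3 [-> h2 h3]]].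
move: h2; rewrite mcoeffX; have [<- _|_] := eqVneq m' m2; last by rewrite eqxx.
by rewrite eqm_add2l revlex_add2l => ne; apply: hi => //; rewrite mcoeff_msupp.
Qed.

Lemma exists_initial d f : hdeg d f -> f != 0 -> exists m, is_initial_monomial f m.
Proof.
move=> hf; rewrite -msupp_eq0 => hs.
have hmax (s : seq 'X_{1..n}) : s != [::] -> exists2 m, m \in s &
    forall m', m' \in s -> (revlex_rank d m' <= revlex_rank d m)%N.
  elim: s => // x [|x' s] IH _.
    by exists x; rewrite ?mem_head // => m'; rewrite mem_seq1 => /eqP ->.
  have [//|m hm h] := IH.
  have [le|lt] := leqP (revlex_rank d x) (revlex_rank d m).
    by exists m; [rewrite inE hm orbT|move=> m'; rewrite inE => /orP [/eqP ->|/h]].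
  exists x; first exact: mem_head.
  move=> m'; rewrite inE => /orP [/eqP -> //|/h h']; exact: leq_trans h' (ltnW lt).
have [m hm h] := hmax _ hs; exists m; split=> // m' hm' ne.
have e : mdeg m' = mdeg m.
  by move: hm hm'; rewrite !mcoeff_msupp => /hf h1 /hf; rewrite -h1 => -[].
have hd : (mdeg m)%:Z = d by apply: hf; rewrite -mcoeff_msupp.
rewrite -(revlex_rankP (d := d)) ?e // ltn_neqAle h // andbT.
by apply: contra ne => /eqP /(revlex_rank_inj (etrans (congr1 Posz e) hd) hd) ->.
Qed.

Lemma init_mon_homog J m : hgraded J -> init_mon J m ->
  exists f, [/\ J f, hdeg (mdeg m) f & is_initial_monomial f m].
Proof.
move=> [_ hJ] [f hf [hm hi]]; exists (hcomp (mdeg m) f); split.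
- exact: hJ.
- exact: hdeg_hcomp.
- split=> [|m']; first by move: hm; rewrite !mcoeff_msupp mcoeff_hcomp eqxx.
  rewrite mcoeff_msupp mcoeff_hcomp; case: ifP => _; last by rewrite eqxx.
  by rewrite -mcoeff_msupp; apply: hi.
Qed.

Lemma init_monMl J m' m : is_ideal J -> init_mon J m -> init_mon J (m' + m)%MM.
Proof.
move=> [_ _ hM] [f hf hm]; exists ('X_[m'] * f); first exact: hM.
exact: is_initialMX.
Qed.

Lemma is_initial_cancel d f g m : hdeg d f -> hdeg d g ->
  is_initial_monomial f m -> is_initial_monomial g m ->
  forall m', m' \in msupp (f - (f@_m / g@_m)%:MP * g) ->
    (revlex_rank d m' < revlex_rank d m)%N.
Proof.
move=> hf hg If Ig m'; rewrite mcoeff_msupp mcoeffB mcoeffCM.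
have g0 : g@_m != 0 by rewrite -mcoeff_msupp; case: Ig.
case: (eqVneq m' m) => [->|ne]; first by rewrite divfK // subrr eqxx.
have [e|] := eqVneq f@_m' 0; last by rewrite -mcoeff_msupp => h _; apply: (is_initial_rank hf If).
rewrite e sub0r oppr_eq0 mulf_eq0 => /norP [_]; rewrite -mcoeff_msupp => h.
exact: (is_initial_rank hg Ig).
Qed.

(** For each m in s choose a homogeneous element of L with initial monomial m. These are independent
    modulo J by their initial monomials, and division with remainder shows that they span. *)
Lemma quot_dim_initial J L d (s : seq 'X_{1..n}) : hgraded J -> hgraded L -> incl J L -> uniq s ->
  (forall m, m \in s <-> [/\ (mdeg m)%:Z = d, init_mon L m & ~ init_mon J m]) ->
  quot_dim (V := R^o) (fun p => L p /\ hdeg d p) J (size s).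
Proof.
move=> gJ gL sJL us hs; have [iJ _] := gJ; have [iL _] := gL.
have hs' (a : 'I_(size s)) := (proj1 (hs _)) (mem_nth 0%MM (ltn_ord a)).
have /fin_all_exists [f hf] (a : 'I_(size s)) : exists f, [/\ L f, hdeg d f & is_initial_monomial f (nth 0%MM s a)].
  by have [<- h _] := hs' a; apply: init_mon_homog.
have hsum (c : 'I_(size s) -> K) : hdeg d (\sum_a (c a)%:MP * f a).
  by apply: hdeg_sum => a; apply: hdegCM; have [] := hf a.
exists f; split.
- by move=> a; have [] := hf a.
- move=> c hc a; apply/eqP/negPn/negP => ca.
  (* The largest monomial with a nonzero coefficient is initial for the combination, hence for J,
     which s excludes. *)
  case: (arg_maxnP (P := fun b => c b != 0) (fun b => revlex_rank d (nth 0%MM s b)) ca) => b cb hmax'.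
  have hmax x : c x != 0 -> (revlex_rank d (nth 0%MM s x) <= revlex_rank d (nth 0%MM s b))%N.
    exact: hmax'.
  have [] := hs' b; move=> _ _; apply; exists (\sum_a (c a)%:MP * f a) => //.
  have key m : m \in msupp (\sum_a (c a)%:MP * f a) -> m = (nth 0%MM s b) \/
      (revlex_rank d m < revlex_rank d (nth 0%MM s b))%N.
    move=> hm; have : exists2 x, c x != 0 & m \in msupp (f x).
      apply: NNPP => hn; move: hm; rewrite mcoeff_msupp raddf_sum /= big1 ?eqxx // => x _.
      rewrite mcoeffCM; have [->|cx] := eqVneq (c x) 0; first by rewrite mul0r.
      by rewrite (memN_msupp_eq0 (p := f x)) ?mulr0 //; apply/negP => hx; apply: hn; exists x.
    move=> [x cx hx]; have [_ dx ix] := hf x.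
    have [->|ne] := eqVneq m (nth 0%MM s x); last first.
      by right; apply: leq_trans (is_initial_rank dx ix hx ne) (hmax _ cx).
    have := hmax _ cx; rewrite leq_eqVlt => /predU1P [e|]; last by right.
    by left; apply: (revlex_rank_inj (d := d)) => //; [case: (hs' x)|case: (hs' b)].
  have hb : (nth 0%MM s b) \in msupp (\sum_a (c a)%:MP * f a).
    have [_ db ib] := hf b.
    rewrite mcoeff_msupp raddf_sum (bigD1 b) //= big1 => [|x nx].
      by rewrite addr0 mcoeffCM mulf_neq0 // -mcoeff_msupp; case: ib.
    rewrite mcoeffCM; have [->|cx] := eqVneq (c x) 0; first by rewrite mul0r.
    have [_ dx ix] := hf x.
    rewrite (memN_msupp_eq0 (p := f x)) ?mulr0 //; apply/negP => hx.
    have : (revlex_rank d (nth 0%MM s b) < revlex_rank d (nth 0%MM s x))%N.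
      apply: (is_initial_rank dx ix hx); rewrite nth_uniq // eq_sym.
      by apply: contra nx => /eqP /val_inj ->.
    by rewrite ltnNge hmax //=.
  split=> // m' hm' ne; case: (key _ hm') => [e|]; first by rewrite e eqxx in ne.
  rewrite revlex_rankP //; last by case: (hs' b).
  by apply: (hsum c); rewrite -mcoeff_msupp.
- move=> z [Lz dz].
  (* Induction on a bound N for the ranks of the monomials of z; each reduction removes the top
     one. *)
  have [N hN] : exists N, forall m, m \in msupp z -> (revlex_rank d m < N)%N.
    by exists (size (monomials n d)).+1 => m _; rewrite ltnS count_size.
  elim: N z Lz dz hN => [|N IH] z Lz dz hN.
    exists (fun=> 0); rewrite big1 ?subr0 => [|a _]; last by rewrite mpolyC0 scale0r.
    suff -> : z = 0 by case: iJ.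
    apply/eqP; rewrite -msupp_eq0; case: (msupp z) hN => // m l.
    by move=> /(_ m (mem_head _ _)).
  have [->|z0] := eqVneq z 0.
    exists (fun=> 0); rewrite big1 ?subr0 => [|a _]; last by rewrite mpolyC0 scale0r.
    by case: iJ.
  have [m im] := exists_initial dz z0.
  have hm : (mdeg m)%:Z = d by apply: dz; rewrite -mcoeff_msupp; case: im.
  have red g : L g -> hdeg d g -> is_initial_monomial g m ->
      exists c : 'I_(size s) -> K, J (z - (z@_m / g@_m)%:MP * g - \sum_a (c a)%:MP * f a).
    move=> Lg dg ig; apply: IH.
    - by apply: (idealB iL) => //; case: iL => _ _; apply.
    - by apply: hdegD => //; apply/hdegN/hdegCM.
    - move=> m' hm'; apply: leq_trans (is_initial_cancel dz dg im ig hm') _.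
      by rewrite -ltnS; apply: hN; case: im.
  (* If m is initial for J, reduce by an element of J, which keeps the class. Otherwise m is in s,
     and the coefficient of the matching [f a] is adjusted. *)
  have [/(init_mon_homog gJ) [g [Jg dg ig]]|nJ] := classic (init_mon J m).
    have [||c hc] := red g _ _ ig; [exact: sJL|by rewrite -hm|exists c].
    apply: (ideal_subr iJ (q := (z@_m / g@_m)%:MP * g)); first by rewrite addrAC.
    by case: iJ => _ _; apply.
  have [a ha] : exists a : 'I_(size s), (nth 0%MM s a) = m.
    have ms : m \in s by apply/hs; split=> //; exists z.
    have hi : (index m s < size s)%N by rewrite index_mem.
    by exists (Ordinal hi) => /=; rewrite nth_index.
  have [La da]:= hf a; rewrite ha => ia; have [c hc] := red _ La da ia.
  exists (fun b => c b + (if b == a then z@_m / (f a)@_m else 0)).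
  rewrite (eq_bigr (fun b => (c b)%:MP * f b + (if b == a then z@_m / (f a)@_m else 0)%:MP * f b)); last first.
    by move=> b _; rewrite mpolyCD; exact: mulrDl.
  have e : \sum_b (if b == a then z@_m / (f a)@_m else 0)%:MP * f b =
      (z@_m / (f a)@_m)%:MP * f a.
    rewrite (bigD1 a) //= eqxx big1 ?addr0 // => b /negbTE ->.
    by rewrite mpolyC0 mul0r.
  by rewrite big_split /= e addrC opprD addrA.
Qed.

End InitialMonomials.

Section InitialIdeal.

Variables (n : nat) (K : fieldType).
Local Notation R := {mpoly K[n]}.
Implicit Types (I J L : R -> Prop) (p q c f g w : R) (m : 'X_{1..n}) (r : nat) (d : int).

Lemma graded_ideal_hgraded I : graded_ideal I -> hgraded I.
Proof.
move=> [S [hS hI]].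
have iI : is_ideal I.
  have [h0 hD hM] := ideal_gen_ideal S; split; first exact/hI.
    by move=> p q /hI hp /hI hq; apply/hI/hD.
  by move=> c p /hI hp; apply/hI/hM.
split=> // d p /hI [k [c [g [hg ->]]]]; rewrite hcomp_sum; apply: ideal_sum => // a.
have [e he] := hS _ (hg a); rewrite (hcompM _ _ (proj1 (in_degreeP e _) he)).
by case: iI => _ _; apply; apply/hI/mem_ideal_gen.
Qed.

Lemma ideal_of_monomials I p : is_ideal I ->
  (forall m, m \in msupp p -> I 'X_[m]) -> I p.
Proof.
move=> [h0 hD hM] h; rewrite (mpolyE p) big_seq; elim/big_ind: _ => // m hm.
by rewrite -mul_mpolyC; apply/hM/h.
Qed.

(** Initial monomials are closed under multiplication by monomials, so they span the ideal they
    generate. *)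
Lemma initial_idealP J p : is_ideal J ->
  (initial_ideal J p <-> forall m, m \in msupp p -> init_mon J m).
Proof.
move=> iJ; split=> [[k [c [g [hg ->]]]] m|h].
  rewrite mcoeff_msupp => hm.
  have [a ha] : exists a, (c a * g a)@_m != 0.
    apply: NNPP => hn; move: hm; rewrite raddf_sum /= big1 ?eqxx // => a _.
    by apply/eqP/negPn/negP => h; apply: hn; exists a.
  have [m1 [m2 [-> _]]] := mcoeffM_neq0 ha.
  have [f [m' [hf hm' ->]]] := hg a; rewrite mcoeffX.
  have [<- _|_] := eqVneq m' m2; last by rewrite eqxx.
  by apply: init_monMl => //; exists f.
apply: ideal_of_monomials; first exact: ideal_gen_ideal.
by move=> m /h [f hf hm]; apply: mem_ideal_gen; exists f, m.
Qed.

Lemma initial_idealX J m : is_ideal J -> (initial_ideal J 'X_[m] <-> init_mon J m).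
Proof.
move=> iJ; rewrite initial_idealP //; split=> [h|h m'].
  by apply: h; rewrite msuppX mem_head.
by rewrite msuppX mem_seq1 => /eqP ->.
Qed.

Lemma monomial_init_mon J m : (forall p, J p -> forall m, m \in msupp p -> J 'X_[m]) ->
  (init_mon J m <-> J 'X_[m]).
Proof.
move=> h; split=> [[f hf [hm _]]|hm]; first exact: h hm.
by exists 'X_[m] => //; apply: is_initialX.
Qed.

Lemma initial_ideal_hgraded J : is_ideal J -> hgraded (initial_ideal J).
Proof.
move=> iJ; split=> [|d p]; first exact: ideal_gen_ideal.
rewrite !initial_idealP // => h m; rewrite mcoeff_msupp mcoeff_hcomp.
by case: ifP => _; [rewrite -mcoeff_msupp => /h|rewrite eqxx].
Qed.

Lemma initial_ideal_monomials J p : is_ideal J -> initial_ideal J p ->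
  forall m, m \in msupp p -> initial_ideal J 'X_[m].
Proof. by move=> iJ /initial_idealP h m /h; rewrite initial_idealX //; apply. Qed.

Lemma init_mon_initial J m : is_ideal J -> (init_mon (initial_ideal J) m <-> init_mon J m).
Proof.
move=> iJ; rewrite -(initial_idealX m iJ); apply: monomial_init_mon => p.
exact: initial_ideal_monomials.
Qed.

Lemma chain_hgraded I r : (r <= n)%N -> hgraded I -> hgraded (chain I r).
Proof.
move=> hr [iI hI]; split=> [|d p]; first exact: chain_ideal.
move=> /(chainP _ _ hr) [a ha la]; apply/(chainP _ _ hr).
by exists (hcomp d a); [exact: hI|rewrite -hcompB; apply: last_ideal_hcomp].
Qed.

(** If the initial monomial of f avoids the last r variables, replace f by an element of I congruent
    to it modulo P_r: the terms that change are smaller by [revlex_in_last]. *)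
Lemma init_mon_chain I r m : (r <= n)%N -> hgraded I ->
  (init_mon (chain I r) m <-> init_mon I m \/ in_last r m).
Proof.
move=> hr gI; have [iI hI] := gI; split.
  move=> /(init_mon_homog (chain_hgraded hr gI)) [f [/(chainP _ _ hr) [a ha la] df [hm im]]].
  have [|hl] := boolP (in_last r m); [by right|left].
  have hco m' : ~~ in_last r m' -> mdeg m' = mdeg m -> (hcomp (mdeg m) a)@_m' = f@_m'.
    move=> hl' e; rewrite mcoeff_hcomp e eqxx; apply/esym/eqP; rewrite -subr_eq0 -mcoeffB.
    by apply: contraNT hl' => /la.
  exists (hcomp (mdeg m) a); first exact: hI.
  split=> [|m' hm' ne]; first by rewrite mcoeff_msupp hco // -mcoeff_msupp.
  have e : mdeg m' = mdeg m.
    by move: hm'; rewrite mcoeff_msupp => /(@hdeg_hcomp _ _ _ a) [].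
  have [hl'|hl'] := boolP (in_last r m'); first exact: revlex_in_last hl' hl.
  by apply: im ne; move: hm'; rewrite !mcoeff_msupp hco.
move=> [[f hf im]|hl].
  by exists f => //; apply/(chainP _ _ hr); exists f; rewrite // subrr; apply: last_ideal0.
exists 'X_[m]; last exact: is_initialX.
apply: last_ideal_chain => // m'; rewrite mcoeffX.
by have [<-|_] := eqVneq m m'; last by rewrite eqxx.
Qed.

Lemma chain_initial I r p : (r <= n)%N -> hgraded I ->
  (chain (initial_ideal I) r p <-> initial_ideal (chain I r) p).
Proof.
move=> hr gI; have [iI hI] := gI.
have iI' : is_ideal (initial_ideal I) by apply: ideal_gen_ideal.
rewrite initial_idealP; last exact: chain_ideal.
rewrite (chainP _ _ hr); split=> [[a ha la] m hm|h].
  apply/init_mon_chain => //; have [|hl] := boolP (in_last r m); [by right|left].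
  apply: (proj1 (initial_idealP a iI) ha); move: hm; rewrite !mcoeff_msupp.
  rewrite (_ : p@_m = a@_m) //; apply/eqP; rewrite -subr_eq0 -mcoeffB.
  by apply: contraNT hl => /la.
exists (mfilter (fun m => ~~ in_last r m) p).
  apply/initial_idealP => // m; rewrite mcoeff_msupp mcoeff_filter.
  case: ifP => [hl|_]; last by rewrite eqxx.
  by rewrite -mcoeff_msupp => /h /(init_mon_chain _ hr gI) [//|]; rewrite (negbTE hl).
move=> m; rewrite mcoeffB mcoeff_filter; case: ifP => [_|/negbFE //].
by rewrite subrr eqxx.
Qed.

Lemma colon_hgraded J x : hgraded J -> hdeg 1 x -> hgraded (colon J (principal x)).
Proof.
move=> [iJ hJ] hx; split=> [|d p]; first exact: colon_ideal.
move=> /(colon_principal iJ) hp; apply/(colon_principal iJ).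
by rewrite -[d](addrK 1) -(hcompM _ _ hx); apply: hJ.
Qed.

Section Step.

Variables (r : nat) (hr : (r < n)%N).
Local Notation y := (next_index hr).
Local Notation Y := (next_var n K r).

Lemma in_last_next m : in_last r (U_(y) + m)%MM = in_last r m.
Proof.
apply/in_lastP/in_lastP => -[k [h1 h2]]; exists k; split=> //; move: h2; rewrite mnmDE mnm1E; last by lia.
by case: eqP => // e; move: h1; rewrite -e /=; lia.
Qed.

(** The colon of a monomial ideal by a variable is monomial, so its initial monomials are the
    monomials it contains. *)
Lemma init_mon_colon_initial J m : is_ideal J ->
  (init_mon (colon (initial_ideal J) (principal Y)) m <-> init_mon J (U_(y) + m)%MM).
Proof.
move=> iJ; have iJ' : is_ideal (initial_ideal J) by apply: ideal_gen_ideal.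
rewrite monomial_init_mon.
  by rewrite (colon_principal iJ') next_varE mulrC -mpolyXD initial_idealX.
move=> p /(colon_principal iJ') hp m' hm'; apply/(colon_principal iJ').
rewrite next_varE mulrC -mpolyXD; apply: initial_ideal_monomials hp _ _ => //.
by rewrite mulrC next_varE mcoeff_msupp mcoeffMXl -mcoeff_msupp.
Qed.

(* The reverse lexicographic order is used here: if an element of J has an
   initial monomial divisible by the next variable, then it lies in the ideal of
   the last r.+1 variables. *)
Lemma init_mon_colon J m : hgraded J -> incl (last_ideal r) J ->
  (init_mon (colon J (principal Y)) m <-> init_mon J (U_(y) + m)%MM).
Proof.
move=> gJ hJ; have [iJ _] := gJ; split.
  move=> [f /(colon_principal iJ) hf im]; exists ('X_y * f); last exact: is_initialMX.
  by rewrite mulrC -next_varE.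
have [hl _|hl] := boolP (in_last r m).
  exists 'X_[m]; last exact: is_initialX.
  apply/(colon_principal iJ)/hJ/last_idealMr => m'; rewrite mcoeffX.
  by have [<-|_] := eqVneq m m'; last by rewrite eqxx.
move=> /(init_mon_homog gJ) [g [Jg dg [hm im]]].
(* A monomial of g outside P_{r+1} would exceed the initial one, which the next variable divides. *)
have lg : last_ideal r.+1 g.
  have hU : in_last r.+1 (U_(y) + m)%MM by rewrite (in_lastS hr) mnmDE mnm1E eqxx.
  move=> m' hm'; have [->//|ne] := eqVneq m' (U_(y) + m)%MM.
  apply: contraT => hl'; have := im m'; rewrite mcoeff_msupp => /(_ hm' ne) h1.
  have e : mdeg m' = mdeg (U_(y) + m)%MM by have [] := dg _ hm'.
  by have := revlex_trans h1 (revlex_in_last (esym e) hU hl'); rewrite revlex_irr.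
have [w [hw _]] := last_ideal_decomp hr lg.
(* The terms dropped lie in P_r, hence in J; multiplication by the next variable embeds the
   remaining support in that of g. *)
pose w' := mfilter (fun m => ~~ in_last r m) w.
have hww : last_ideal r (w - w').
  move=> m'; rewrite mcoeffB mcoeff_filter; case: ifP => [_|/negbFE //].
  by rewrite subrr eqxx.
have co m' : ~~ in_last r m' -> w'@_m' = g@_(U_(y) + m')%MM.
  move=> hl'; rewrite mcoeff_filter hl' -(mcoeffMXl w U_(y)%MM) -[X in X * w]next_varE.
  apply/esym/eqP; rewrite -subr_eq0 -mcoeffB; apply: contraNT hl' => /hw.
  by rewrite in_last_next.
exists w'.
  apply/(colon_principal iJ)/(ideal_subr iJ (q := g)) => //; apply: hJ.
  rewrite -(subrKA (w * Y)) -mulrBl; apply: last_idealD.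
    by apply: last_idealMr; rewrite -opprB; apply: last_idealN.
  by rewrite -opprB mulrC; apply: last_idealN.
split=> [|m']; first by rewrite mcoeff_msupp co // -mcoeff_msupp.
rewrite mcoeff_msupp => hm' ne.
have hl' : ~~ in_last r m'.
  by move: hm'; rewrite mcoeff_filter; case: ifP => //; rewrite eqxx.
rewrite -(revlex_add2l U_(y)%MM); apply: im; rewrite ?eqm_add2l //.
by rewrite mcoeff_msupp -co.
Qed.

(** The same list of monomials gives a basis of both quotients. *)
Lemma quot_dim_colon_initial I d : hgraded I -> exists k,
  quot_dim (V := R^o) (fun p => chain I r (p * Y) /\ hdeg d p) (chain I r) k /\
  quot_dim (V := R^o) (fun p => chain (initial_ideal I) r (p * Y) /\ hdeg d p)
    (chain (initial_ideal I) r) k.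
Proof.
move=> gI; have [iI _] := gI; have hr' := ltnW hr.
pose J := chain I r; have gJ : hgraded J by apply: chain_hgraded.
have [iJ _] := gJ; have hY : hdeg 1 Y by apply: hdeg_next_var.
have lJ : incl (last_ideal r) J by move=> p; apply: last_ideal_chain.
have iJ' : is_ideal (initial_ideal J) by apply: ideal_gen_ideal.
have gJ' := initial_ideal_hgraded iJ.
pose Q m := init_mon (colon J (principal Y)) m /\ ~ init_mon J m.
(* Excluded middle turns the proposition Q into a boolean filter. *)
pose s := [seq m <- monomials n d | if excluded_middle_informative (Q m) then true else false].
have us : uniq s by rewrite filter_uniq // monomials_uniq.
have hs m : m \in s <-> [/\ (mdeg m)%:Z = d, init_mon (colon J (principal Y)) m & ~ init_mon J m].
  rewrite mem_filter mem_monomials; case: excluded_middle_informative => h.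
    by split=> [/eqP e|[-> _ _]]; [case: h|rewrite eqxx].
  by split=> // -[_ h1 h2]; case: h.
have hsub L : is_ideal L -> incl L (colon L (principal Y)).
  by move=> iL p hp; apply/(colon_principal iL); rewrite mulrC; case: iL => _ _; apply.
exists (size s); split.
  apply: quot_dim_ext (quot_dim_initial gJ (colon_hgraded gJ hY) (hsub _ iJ) us hs) => // p.
  by rewrite (colon_principal iJ).
apply: quot_dim_ext (quot_dim_initial gJ' (colon_hgraded gJ' hY) (hsub _ iJ') us _) => [p|p|m].
- by rewrite (colon_principal iJ') (chain_initial _ hr' gI); apply: iff_refl.
- by rewrite (chain_initial _ hr' gI); apply: iff_refl.
- have e1 := init_mon_initial m iJ; have e2 := init_mon_colon_initial m iJ.
  have e3 := init_mon_colon m gJ lJ; rewrite hs.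
  by split=> -[? h1 h2]; split=> //; [apply/e2/e3|move=> /e1|apply/e3/e2|move=> /e1].
Qed.

End Step.
End InitialIdeal.

(** * Modules of finite length *)

Section FiniteLength.

Variables (n : nat) (K : fieldType).
Local Notation R := {mpoly K[n]}.
Implicit Types (I J M N : R -> Prop) (p q a b : R) (m : 'X_{1..n}) (d : nat).

Lemma uniform_bound (l : nat) (P : nat -> nat -> Prop) :
  (forall k, (k < l)%N -> exists D, forall d, (D <= d)%N -> P k d) ->
  exists D, forall k d, (k < l)%N -> (D <= d)%N -> P k d.
Proof.
elim: l => [|l IH] h; first by exists 0%N.
have [|D hD] := IH; first by move=> k hk; apply: h; apply: ltnW.
have [D' hD'] := h l (ltnSn l); exists (maxn D D') => k d.
rewrite ltnS leq_eqVlt geq_max => /predU1P [->|hk] /andP [h1 h2]; [exact: hD'|exact: hD].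
Qed.

(** This is N + M_{>= d}, with M_{>= d} the elements of M without terms of degree below d. *)
Definition trunc_ge M N d p : Prop :=
  exists a b, [/\ p = a + b, M a, N b & forall m, a@_m != 0 -> (d <= mdeg m)%N].

Section Truncation.

Variables (M N : R -> Prop) (iM : is_ideal M) (iN : is_ideal N).

Lemma trunc_ge_ideal d : is_ideal (trunc_ge M N d).
Proof.
have [M0 MD MM] := iM; have [N0 ND NM] := iN; split.
- by exists 0, 0; split=> //; rewrite ?addr0 // => m; rewrite mcoeff0 eqxx.
- move=> _ _ [a [b [-> Ma Nb ha]]] [a' [b' [-> Ma' Nb' ha']]].
  exists (a + a'), (b + b'); split; [by rewrite addrACA|exact: MD|exact: ND|].
  move=> m; rewrite mcoeffD; case: (eqVneq a@_m 0) => [->|/ha //].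
  by rewrite add0r => /ha'.
- move=> c _ [a [b [-> Ma Nb ha]]]; exists (c * a), (c * b).
  split; [by rewrite mulrDr|exact: MM|exact: NM|].
  by move=> m /mcoeffM_neq0 [m1 [m2 [-> _ /ha h]]]; rewrite mdegD; lia.
Qed.

Lemma trunc_geS d d' : (d <= d')%N -> incl (trunc_ge M N d') (trunc_ge M N d).
Proof. by move=> hd p [a [b [-> Ma Nb ha]]]; exists a, b; split=> // m /ha; lia. Qed.

Lemma sub_trunc_ge d : incl N (trunc_ge M N d).
Proof.
by move=> p hp; exists 0, p; split; rewrite ?add0r //; [case: iM|move=> m; rewrite mcoeff0 eqxx].
Qed.

(** S d, the sum of C and the part of C' in N + M_{>= d}, lies between C and C', so it equals one of
    them. If it is C for some d, then c = p works from there on; otherwise it is always C', and S (d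
    + 1) supplies c. *)
Lemma simple_truncation C C' : is_ideal C -> is_ideal C' -> simple_quotient C' C ->
  exists D, forall d, (D <= d)%N -> forall p, C' p -> trunc_ge M N d p ->
    exists c, C c /\ C' (p - c) /\ trunc_ge M N d.+1 (p - c).
Proof.
move=> iC iC' [sub _ simple]; have [C0 CD CM] := iC; have [C'0 C'D C'M] := iC'.
pose S d p := exists q c, [/\ p = q + c, C' q, trunc_ge M N d q & C c].
have iS d : is_ideal (S d).
  have [T0 TD TM] := trunc_ge_ideal d; split.
  - by exists 0, 0; split; rewrite ?addr0.
  - move=> _ _ [q [c [-> h1 h2 h3]]] [q' [c' [-> h1' h2' h3']]].
    by exists (q + q'), (c + c'); split; [rewrite addrACA|exact: C'D|exact: TD|exact: CD].
  - move=> x _ [q [c [-> h1 h2 h3]]].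
    by exists (x * q), (x * c); split; [rewrite mulrDr|exact: C'M|exact: TM|exact: CM].
have subS d : incl C (S d).
  by move=> p hp; exists 0, p; split; rewrite ?add0r //; apply/sub_trunc_ge; case: iN.
have Ssub d : incl (S d) C' by move=> p [q [c [-> h1 _ /sub h3]]]; apply: C'D.
have [[d0 hd0]|hno] := classic (exists d, same_ideal (S d) C).
  exists d0 => d hd p hp hT; exists p; rewrite subrr; split; last first.
    by split; [case: iC'|case: (trunc_ge_ideal d.+1)].
  by apply/hd0; exists p, 0; split; rewrite ?addr0 //; apply: trunc_geS hT.
exists 0%N => d _ p hp _; have [h|h] := simple _ (iS d.+1) (@subS _) (@Ssub _).
  by case: hno; exists d.+1.
have [q [c [-> h1 h2 h3]]] := proj2 (h p) hp.
by exists c; rewrite addrK.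
Qed.

(** Climbing the composition series shows that, for d >= D, each element of N + M_{>= d} lies in N +
    M_{>= d+1}. For p homogeneous of degree d, taking the component of degree d leaves an element of
    N. *)
Lemma finite_length_degree : (forall e p, N p -> N (hcomp e p)) ->
  finite_length_quotient M N ->
  exists D, forall d p, (D <= d)%N -> M p -> hdeg d p -> N p.
Proof.
move=> gN [l [C [iC C0 Cl hC]]].
have [|D hD] := @uniform_bound l (fun k d => forall p, C k.+1 p -> trunc_ge M N d p ->
    exists c, C k c /\ C k.+1 (p - c) /\ trunc_ge M N d.+1 (p - c)).
  move=> k hk; apply: simple_truncation; [exact/iC/ltnW|exact/iC|exact: hC].
exists D => d p hd Mp dp.
have key k : (k <= l)%N -> forall p, C k p -> trunc_ge M N d p -> trunc_ge M N d.+1 p.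
  elim: k => [_ q /C0 hq _|k IH hk q hq hT]; first exact: sub_trunc_ge.
  have [c [h1 [h2 h3]]] := hD _ _ hk hd _ hq hT.
  have iT := trunc_ge_ideal d; have iT' := trunc_ge_ideal d.+1.
  apply: (ideal_subr iT' h3); apply: IH => //; first exact: ltnW.
  rewrite -[c](subKr q); apply: idealB => //; exact: trunc_geS h3.
have [||a [b [e Ma Nb ha]]] := key _ (leqnn l) p; first exact/Cl.
  by exists p, 0; split; rewrite ?addr0 //; [case: iN|move=> m /dp []->].
rewrite -(hcomp_id dp) e hcompD (_ : hcomp d a = 0) ?add0r; first exact: gN.
apply/mpolyP => m; rewrite mcoeff_hcomp mcoeff0; case: eqP => // -[hm].
by apply/eqP/negPn/negP => /ha; rewrite hm ltnn.
Qed.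

End Truncation.
End FiniteLength.

(** * Betti numbers *)

(** The rows of W form a basis of A modulo B: W meets B trivially, W + B = A + B, and the ranks are
    counted. *)
Lemma mxrank_diff_basis (K : fieldType) m1 m2 m k (A : 'M[K]_(m1, m)) (B : 'M[K]_(m2, m))
    (W : 'M[K]_(k, m)) : (W <= A)%MS -> (A <= W + B)%MS ->
  (forall c : 'rV_k, (c *m W <= B)%MS -> c = 0) -> \rank (A :\: B)%MS = k.
Proof.
move=> hWA hAWB hfree.
have rW : \rank W = k.
  apply/eqP; rewrite -/(row_free W) -kermx_eq0; apply/eqP/row_matrixP => i.
  by rewrite row0; apply: hfree; rewrite -row_mul mulmx_ker row0 sub0mx.
have capW : (W :&: B)%MS = 0.
  apply/eqP; rewrite -submx0; apply/rV_subP => x; rewrite sub_capmx => /andP [].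
  by move=> /submxP [c ->] /hfree ->; rewrite mul0mx sub0mx.
have e : \rank (A + B)%MS = \rank (W + B)%MS.
  apply: eqmx_rank; apply/andP; split.
    by rewrite addsmx_sub hAWB addsmxSr.
  by rewrite addsmxS.
have := mxrank_sum_cap A B; have := mxrank_sum_cap W B; have := mxrank_cap_compl A B.
rewrite e capW mxrank0 rW; lia.
Qed.

Section Resolution.

Variables (n : nat) (K : fieldType).
Local Notation R := {mpoly K[n]}.
Variables (I : R -> Prop) (F : graded_free_resolution I).

(* The resolution of I, prolonged by I -> R to a resolution of R / I. *)
Definition res_rank i : nat := if i is i'.+1 then gr_rank F i' else 1.

Definition res_deg i : 'I_(res_rank i) -> int :=
  if i is i'.+1 then @gr_deg _ _ _ F i' else fun=> 0.

Definition res_diff i : 'M[R]_(res_rank i.+1, res_rank i) :=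
  if i is i'.+1 then gr_diff F i' else gr_aug F.

Lemma res_diff_homog i a b :
  hdeg (@res_deg i.+1 a - @res_deg i b) (@res_diff i a b).
Proof.
apply/in_degreeP; case: i a b => [|i] a b /=; last exact: gr_diff_homog.
by rewrite subr0 (ord1 b); apply: gr_aug_homog.
Qed.

Lemma res_diffK i : res_diff i.+1 *m res_diff i = 0.
Proof.
apply/row_matrixP => a; rewrite row0 row_mul; case: i a => [|i] a /=.
  by apply/gr_exact0; exists (delta_mx 0 a); rewrite rowE.
by apply/gr_exactS; exists (delta_mx 0 a); rewrite rowE.
Qed.

Lemma res_exact i (u : 'rV_(res_rank i.+1)) :
  u *m res_diff i = 0 -> exists v, u = v *m res_diff i.+1.
Proof. by case: i u => [|i] u /=; [move/gr_exact0|move/gr_exactS]. Qed.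

Local Notation rcyc r i d := (@cyc n K res_rank res_deg res_diff r i d).
Local Notation rbd r i := (@bd n K res_rank res_diff r i).
Local Notation rker r i d := (@mul_ker n K res_rank res_deg res_diff r i d).
Local Notation rdeg i d := (@row_deg n K res_rank res_deg i d).
Local Notation const := (map_mx (mcoeff 0%MM)).

Lemma bd_chain r (u : 'rV[R]_1) : (r <= n)%N -> (rbd r 0 u <-> chain I r (u 0 0)).
Proof.
move=> hr; split=> [[v hv]|/(chainP _ _ hr) [a ha la]].
  apply/(chainP _ _ hr); exists ((v *m gr_aug F) 0 0); first by apply/gr_aug_onto; exists v.
  by have := hv 0; rewrite !mxE.
have [v e] := proj1 (gr_aug_onto F _) ha; exists v => b; rewrite !(ord1 b).
by move: la; rewrite e !mxE.
Qed.

Lemma mul_ker_chain r d (w : 'rV[R]_1) : (r <= n)%N ->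
  (rker r 0 d w <-> chain I r (w 0 0 * next_var n K r) /\ hdeg d (w 0 0)).
Proof.
move=> hr; rewrite /mul_ker bd_chain // !mxE mulrC.
split=> -[h1 h2]; split=> //; first by have := h1 0; rewrite subr0.
by move=> a; rewrite (ord1 a) subr0.
Qed.

Lemma quot_dim_annihilator r d k : (r <= n)%N ->
  quot_dim (V := R^o) (fun p => chain I r (p * next_var n K r) /\ hdeg d p) (chain I r) k ->
  quot_dim (rker r 0 d) (rbd r 0) k.
Proof.
move=> hr; apply: (quot_dim_transfer (delta := fun (u : 'rV[R]_1) (p : R^o) => u 0 0 = p)).
- by rewrite mxE.
- by move=> u u' p p' <- <-; rewrite mxE.
- by move=> c u p <-; rewrite mxE.
- by move=> u /(mul_ker_chain _ _ hr) hu; exists (u 0 0).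
- by move=> p hp; exists p%:M; [apply/(mul_ker_chain _ _ hr)|]; rewrite mxE ?eqxx.
- by move=> u p <-; apply: bd_chain.
Qed.

(** P_n consists of the polynomials without constant term, so reduction modulo it is tensoring with
    K. *)
Lemma const_last m (u : 'rV[R]_m) : row_last n u <-> const u = 0.
Proof.
split=> [h|h a]; first by apply/rowP => a; rewrite !mxE; apply/last_ideal_all.
by apply/last_ideal_all; have := congr1 (fun x : 'rV_m => x 0 a) h; rewrite !mxE.
Qed.

Lemma tor_degreeP i d (x : 'rV_(gr_rank F i)) :
  (x <= tor_degree F i d)%MS <-> forall a, x 0 a != 0 -> @gr_deg _ _ _ F i a = d.
Proof.
have e (y : 'rV_(gr_rank F i)) a :
    (y *m tor_degree F i d) 0 a = y 0 a * (@gr_deg _ _ _ F i a == d)%:R.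
  by rewrite mul_mx_diag !mxE.
split=> [/submxP [y ->] a|h].
  by rewrite e; have [//|_] := eqVneq (@gr_deg _ _ _ F i a) d; rewrite mulr0 eqxx.
apply/submxP; exists x; apply/rowP => a; rewrite e.
by case: (eqVneq (x 0 a) 0) => [->|/h ->]; rewrite ?mul0r // eqxx mulr1.
Qed.

Lemma tor_degree_id i d (x : 'rV_(gr_rank F i)) :
  (x <= tor_degree F i d)%MS -> x *m tor_degree F i d = x.
Proof.
move=> /tor_degreeP h; apply/rowP => a; rewrite mul_mx_diag !mxE.
by case: (eqVneq (x 0 a) 0) => [->|/h ->]; rewrite ?mul0r // eqxx mulr1.
Qed.

Lemma const_deg i (d : int) (u : 'rV[R]_(gr_rank F i)) : rdeg i.+1 d u ->
  (const u <= tor_degree F i d)%MS.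
Proof.
move=> hu; apply/tor_degreeP => a; rewrite mxE => /(hu a).
by rewrite mdeg0 => /esym/eqP; rewrite subr_eq0 => /eqP.
Qed.

Lemma lift_deg i (d : int) (x : 'rV[K]_(gr_rank F i)) : (x <= tor_degree F i d)%MS ->
  rdeg i.+1 d (map_mx (@mpolyC n K) x).
Proof.
move=> /tor_degreeP h a; rewrite mxE; case: (eqVneq (x 0 a) 0) => [->|/h /= ->].
  by rewrite mpolyC0; apply: hdeg0.
by rewrite subrr; apply: hdegC.
Qed.

Lemma const_lift m (x : 'rV[K]_m) : const (map_mx (@mpolyC n K) x) = x.
Proof. by apply/rowP => a; rewrite !mxE mcoeffC eqxx mulr1. Qed.

(** A nonzero constant entry of a homogeneous matrix joins basis vectors of equal degree, so
    projecting to degree d commutes with [tor_diff]. *)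
Lemma tor_boundariesP i d (x : 'rV_(gr_rank F i)) : (x <= tor_degree F i d)%MS ->
  (x <= tor_boundaries F i d)%MS <-> exists v, x = v *m tor_diff F i.
Proof.
move=> hx; split=> [/submxP [v ->]|[v e]].
  by exists (v *m tor_degree F i.+1 d); rewrite mulmxA.
rewrite -(tor_degree_id hx) e -mulmxA; apply/submxP; exists v; congr (_ *m _).
apply/matrixP => a b; rewrite /tor_boundaries mul_mx_diag mul_diag_mx !mxE.
have [->|h] := eqVneq ((gr_diff F i a b)@_0%MM) 0; first by rewrite mul0r mulr0.
have /in_degreeP/(_ _ h) := gr_diff_homog a b.
by rewrite mdeg0 => /esym/eqP; rewrite subr_eq0 => /eqP ->; rewrite mulrC.
Qed.

Lemma bd_boundaries i d (u : 'rV[R]_(gr_rank F i)) :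
  rdeg i.+1 d u ->
  (rbd n i.+1 u <-> (const u <= tor_boundaries F i d)%MS).
Proof.
move=> /const_deg hu; rewrite tor_boundariesP //; split=> [[v /const_last hv]|[v hv]].
  exists (const v); apply/eqP; rewrite -subr_eq0; apply/eqP; rewrite -hv.
  by rewrite map_mxB map_mxM.
exists (map_mx (@mpolyC n K) v); apply/const_last.
by rewrite map_mxB map_mxM const_lift hv subrr.
Qed.

Section Betti.

Variable i : nat.
Hypothesis aug0 : i = 0%N -> const (gr_aug F) = 0.

Lemma cyc_cycles d (u : 'rV[R]_(gr_rank F i)) : rcyc n i d u ->
  (const u <= tor_cycles F i d)%MS.
Proof.
move=> [/const_deg hd /const_last hu].
case: i u hd hu => [|j] u hd hu //=; rewrite sub_capmx hd; apply/sub_kermxP.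
by rewrite -hu map_mxM.
Qed.

(** For i = 0 all of F_0 tensor K are cycles, while the prolonged complex asks for the kernel of the
    augmentation; [aug0] makes these agree. *)
Lemma lift_cycles d (x : 'rV[K]_(gr_rank F i)) : (x <= tor_cycles F i d)%MS ->
  rcyc n i d (map_mx (@mpolyC n K) x).
Proof.
move=> hx; have hd : (x <= tor_degree F i d)%MS.
  by move: x hx; case: i => [|j] x //=; rewrite sub_capmx => /andP [].
split; first exact: lift_deg.
apply/const_last; rewrite map_mxM const_lift.
move: aug0 x hx {hd}; case: i => [|j] h0 x /= hx; first by rewrite h0 ?mulmx0.
by move: hx; rewrite sub_capmx => /andP [_ /sub_kermxP].
Qed.

Lemma betti_quot_dim (d k : nat) : quot_dim (rcyc n i d) (rbd n i.+1) k -> betti F i d = k.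
Proof.
move=> [v [hv hfree hspan]].
have hsum (c : 'I_k -> K) : const (\sum_a (c a)%:MP *: v a) =
    (\row_a c a) *m (\matrix_a const (v a)).
  rewrite mulmx_sum_row raddf_sum; apply: eq_bigr => a _.
  rewrite mxE rowK; apply/rowP => b; rewrite !mxE.
  by rewrite /= mcoeffCM.
have dsum (c : 'I_k -> K) : rdeg i.+1 d (\sum_a (c a)%:MP *: v a).
  elim/big_ind: _ => [a|x y|a _]; [by rewrite mxE; apply: hdeg0|exact: row_degD|].
  by apply: row_degZ; case: (hv a).
apply: (mxrank_diff_basis (W := \matrix_a const (v a))).
- by apply/row_subP => a; rewrite rowK; apply/cyc_cycles.
- apply/rV_subP => x hx; have hz := lift_cycles hx.
  have [c hc] := hspan _ hz.
  have : (const (map_mx (@mpolyC n K) x - \sum_a (c a)%:MP *: v a)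
           <= tor_boundaries F i d)%MS.
    by apply/bd_boundaries => //; apply: row_degD; [case: hz|exact/row_degN].
  rewrite map_mxB const_lift hsum => hb.
  rewrite -(subrK (\row_a c a *m \matrix_a const (v a)) x) addmx_sub //.
    by apply: submx_trans hb (addsmxSr _ _).
  by apply: submx_trans (submxMl _ _) (addsmxSl _ _).
- move=> c hc; have := hfree (fun a => c 0 a) _.
  rewrite (bd_boundaries (d := d)) // hsum (_ : \row_a c 0 a = c); last by apply/rowP => a; rewrite mxE.
  by move=> /(_ hc) h; apply/rowP => a; rewrite mxE.
Qed.

Lemma betti_tor_van (j : nat) :
  betti F i (i + j)%N = 0%N <-> @tor_van n K res_rank res_deg res_diff n i j.
Proof.
split=> [h u hu|h].
  have [du _] := hu; apply/(bd_boundaries du); apply: submx_trans (cyc_cycles hu) _.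
  apply: submx_trans (capmxSr (tor_cycles F i (i + j)%N) _).
  (* A complement of rank zero means that the intersection has the full rank of the cycles. *)
  rewrite -(mxrank_leqif_sup (capmxSl _ _)) -[eqbRHS](mxrank_cap_compl _ (tor_boundaries F i (i + j)%N)).
  by rewrite -[X in X == _]addn0 eqn_add2l; apply/eqP/esym.
apply: betti_quot_dim; exists (fun=> 0); split=> [[]//|c _ []//|z hz].
by exists (fun=> 0); rewrite big_ord0 subr0; apply: h.
Qed.

End Betti.
End Resolution.

(** * Comparison of extremal Betti numbers *)

Section ExtremalBetti.

Variables (n : nat) (K : fieldType).
Local Notation R := {mpoly K[n]}.
Local Notation const := (map_mx (mcoeff 0%MM)).
Local Notation tvan F := (tor_van (@res_deg n K _ F) (@res_diff n K _ F)).
Local Notation kvan F := (ker_van (@res_deg n K _ F) (@res_diff n K _ F)).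

(** An entry with nonzero constant term is homogeneous of degree 0, hence a unit in I. *)
Lemma proper_aug0 (I : R -> Prop) (F : graded_free_resolution I) :
  is_ideal I -> ~ I 1 -> const (gr_aug F) = 0.
Proof.
move=> iI I1; apply/matrixP => a b; rewrite (ord1 b) !mxE.
apply/eqP/negPn/negP => h; apply: I1.
have /in_degreeP ha := gr_aug_homog a.
apply: (ideal_unit iI _ _ h).
  by apply/gr_aug_onto; exists (delta_mx 0 a); rewrite -rowE mxE.
by move: (ha); rewrite -(ha _ h) mdeg0.
Qed.

(** Treats I = R, where [proper_aug0] does not apply. All R / I_r are zero, so the prolonged complex
    is exact modulo every P_r and only Tor_0 = K in degree 0 remains. *)
Lemma betti_unit (I : R -> Prop) (F : graded_free_resolution I) i j :
  is_ideal I -> I 1 -> betti F i (i + j) = ((i == 0%N) && (j == 0%N) : nat).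
Proof.
move=> iI I1; have Iall p : I p by case: iI => _ _ hM; rewrite -[p]mulr1; apply: hM.
have bd_all r (u : 'rV[R]_1) : (r <= n)%N -> @bd n K (res_rank F) (res_diff F) r 0 u.
  move=> hr; apply/bd_chain => //; apply/chainP => //.
  by exists (u 0 0); rewrite // subrr; apply: last_ideal0.
have hT i' j' : tvan F n i' j'.
  apply: tor_van_of_ker0 => //; try exact: res_diff_homog; try exact: res_diffK.
    exact: res_exact.
  by move=> s hs w _; apply: bd_all; lia.
case: i => [|i] /=; last by apply/betti_tor_van.
rewrite add0n.
have inB (x : 'rV[K]_(gr_rank F 0)) : (x <= tor_degree F 0 j)%MS ->
    x *m const (gr_aug F) = 0 -> (x <= tor_boundaries F 0 j)%MS.
  move=> hx h0; have dx := lift_deg hx; rewrite -[x](const_lift n).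
  apply/(bd_boundaries dx)/(hT 0%N j); split=> //.
  by apply/const_last; rewrite map_mxM const_lift.
(* The constant terms of the augmentation live in degree 0, so for j <> 0 they kill every vector of
   degree j, which is therefore a boundary. *)
have [e0|j0] := eqVneq j 0%N; last first.
  apply: (mxrank_diff_basis (W := 0)); first exact: sub0mx.
    apply: submx_trans (addsmxSr _ _); apply/rV_subP => x hx; apply: inB => //.
    apply/rowP => b; rewrite !mxE big1 // => a _; rewrite !mxE.
    have [->|/(proj1 (tor_degreeP _ _) hx) ea] := eqVneq (x 0 a) 0; first by rewrite mul0r.
    have /in_degreeP ha := gr_aug_homog a.
    rewrite (ord1 b) (hdeg_neq ha) ?mulr0 // mdeg0 ea.
    by rewrite eqz_nat eq_sym.
  by move=> c _; apply/rowP => -[].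
(* For j = 0 the constant terms of a homogeneous preimage of 1 span Tor_0. *)
subst j; have [v dv hv] : exists2 v, row_deg (@res_deg n K I F) 0 v &
    row_last n ((1%:M : 'rV[R]_1) - v *m res_diff F 0).
  apply: bd_homog; [exact: res_diff_homog| |exact: bd_all].
  by move=> a; rewrite (ord1 a) !mxE eqxx subr0 -mpolyC1; apply: hdegC.
have ev : const v *m const (gr_aug F) = 1%:M.
  move/const_last: hv; rewrite map_mxB map_mxM map_scalar_mx => /eqP.
  by rewrite subr_eq0 => /eqP <-; rewrite rmorph1.
have hx := const_deg dv.
apply: (mxrank_diff_basis (W := const v)) => //=.
- apply/rV_subP => z hz; set t := z *m const (gr_aug F).
  rewrite -(subrK (t *m const v) z) addmx_sub //.
    apply: submx_trans (addsmxSr _ _); apply: inB.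
      by rewrite addmx_sub // -mulNmx mulmx_sub.
    by rewrite mulmxBl -mulmxA ev mulmx1 subrr.
  by apply: submx_trans (addsmxSl _ _); apply: submxMl.
- move=> c /submxP [w e]; rewrite -[c]mulmx1 -ev mulmxA e -!mulmxA.
  rewrite -map_mxM (res_diffK F 0) (_ : const _ = 0) ?mulmx0 //.
  by apply/matrixP => a b; rewrite !mxE mcoeff0.
Qed.

Definition annihilator_piece (I : R -> Prop) r (d : int) (p : R^o) : Prop :=
  chain I r (p * next_var n K r) /\ hdeg d p.

Section Compare.

Variables (I J : R -> Prop) (F : graded_free_resolution I) (G : graded_free_resolution J).
Hypotheses (iI : is_ideal I) (iJ : is_ideal J) (I1 : ~ I 1) (J1 : ~ J 1)
  (same_dim : forall r d, (r < n)%N -> exists k,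
     quot_dim (annihilator_piece I r d) (chain I r) k /\
     quot_dim (annihilator_piece J r d) (chain J r) k)
  (D : nat)
  (large : forall r (d : nat) p, (r < n)%N -> (D <= d)%N ->
     annihilator_piece I r d p -> chain I r p).

Lemma ker_van_compare s j : (s < n)%N -> kvan F s 0 j -> kvan G s 0 j.
Proof.
move=> hs hF; have [k [qI qJ]] := same_dim (j%:Z - 1) hs.
apply/(quot_dim0P (quot_dim_annihilator G (ltnW hs) qJ)).
exact/(quot_dim0P (quot_dim_annihilator F (ltnW hs) qI)).
Qed.

(** The bound is D + 1 because index j refers to degree j - 1. *)
Lemma ker_van_of_large s j : (s < n)%N -> (D.+1 <= j)%N -> kvan F s 0 j.
Proof.
move=> hs; case: j => // j hj w /(mul_ker_chain _ _ _ (ltnW hs)); rewrite add0n intS addrC addKr.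
by move=> /(large hs hj) h; apply/bd_chain => //; apply: ltnW.
Qed.

(** Both Betti numbers are the dimension of the same annihilator piece, and the vanishing around (i,
    j) passes from F to G through the annihilators. *)
Lemma extremal_compare i j : extremal (betti F) i j ->
  extremal (betti G) i j /\ betti F i (i + j)%N = betti G i (i + j)%N.
Proof.
move=> [h0 hreg].
have bF k l : betti F k (k + l) = 0%N <-> tvan F n k l.
  by apply: betti_tor_van => _; apply: proper_aug0.
have bG k l : betti G k (k + l) = 0%N <-> tvan G n k l.
  by apply: betti_tor_van => _; apply: proper_aug0.
have fwd i0 j0 : (forall k l, (i0 <= k)%N -> (j0 <= l)%N -> betti F k (k + l) = 0%N) ->
    forall s l, (s + i0 < n)%N -> (j0 <= l)%N -> kvan F s 0 l /\ kvan G s 0 l.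
  move=> h s l hs hl.
  have hF : kvan F s 0 l.
    apply: (ker0_of_tor_van (@res_diff_homog _ _ _ F) (@res_diffK _ _ _ F)
      (@res_exact _ _ _ F) ker_van_of_large _ hs hl) => k l' hk hl'.
    exact/bF/h.
  by split=> //; apply: ker_van_compare => //; lia.
have k1 := fwd i.+1 j; have {}k1 := k1 _.
(* The zeros around (i, j) fill two quadrants, with corners (i + 1, j) and (i, j + 1); each gives
   vanishing annihilators. *)
have h1 s l : (s + i.+1 < n)%N -> (j <= l)%N -> kvan F s 0 l /\ kvan G s 0 l.
  by apply: k1 => k l' hk hl; apply: hreg; [lia|done|case; lia].
have h2 s l : (s + i < n)%N -> (j.+1 <= l)%N -> kvan F s 0 l /\ kvan G s 0 l.
  by apply: fwd => k l' hk hl; apply: hreg; [done|lia|case; lia].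
(* For i >= n no s satisfies s + i < n, so the Betti number would vanish. *)
have hi : (i < n)%N.
  rewrite ltnNge; apply/negP => hi; apply/h0/bF.
  apply: tor_van_of_ker0 => //; [exact: res_diff_homog|exact: res_diffK|exact: res_exact|].
  by move=> s hs; lia.
have hs : (n - i.+1 < n)%N by lia.
have [k [qI qJ]] := same_dim (j%:Z - 1) hs.
have eF : betti F i (i + j) = k.
  apply: betti_quot_dim => [_|]; first exact: proper_aug0.
  apply: quot_dim_top => //; [exact: res_diff_homog|exact: res_diffK|exact: res_exact| | |].
  - by move=> s hs'; case: (h1 s j hs').
  - by move=> s hs'; case: (h2 s j.+1 hs').
  - exact/quot_dim_annihilator/qI/ltnW.
have eG : betti G i (i + j) = k.
  apply: betti_quot_dim => [_|]; first exact: proper_aug0.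
  apply: quot_dim_top => //; [exact: res_diff_homog|exact: res_diffK|exact: res_exact| | |].
  - by move=> s hs'; case: (h1 s j hs').
  - by move=> s hs'; case: (h2 s j.+1 hs').
  - exact/quot_dim_annihilator/qJ/ltnW.
split; last by rewrite eF eG.
split=> [|k' l hk hl ne]; first by rewrite eG -eF.
apply/bG/tor_van_of_ker0 => //; [exact: res_diff_homog|exact: res_diffK|exact: res_exact|].
move=> s hs'; have [lt|le] := ltnP i k'; first by apply: (h1 s l _ hl).2; lia.
have [lt|le'] := ltnP j l; first by apply: (h2 s l _ lt).2; lia.
by case: ne; congr pair; lia.
Qed.

End Compare.

Lemma annihilator_large (I : R -> Prop) : hgraded I ->
  (forall i : nat, (1 <= i <= n)%N -> annihilator_finite_length I i) ->
  exists D, forall r (d : nat) p, (r < n)%N -> (D <= d)%N ->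
     annihilator_piece I r d p -> chain I r p.
Proof.
move=> gI hfin; have [iI _] := gI.
have [|D hD] := @uniform_bound n (fun r d => forall p,
    annihilator_piece I r d p -> chain I r p).
  move=> r hr; have gC := chain_hgraded (ltnW hr) gI; have [iC hC] := gC.
  (* Index r + 1 of the hypothesis concerns (I_r : x_{n-r}) / I_r. *)
  have [|D hD] := finite_length_degree (colon_ideal iC _) iC hC (hfin r.+1 _); first by rewrite hr.
  by exists D => d hd p [h1 h2]; apply: hD hd _ h2; apply/(colon_principal iC).
by exists D => r d p hr hd; apply: hD.
Qed.

End ExtremalBetti.

Theorem theorem3p6 (n : nat) (K : fieldType) (hK : infinite_field K)
  (I : {mpoly K[n]} -> Prop) (hI : graded_ideal I)
  (hfin : forall i : nat, (1 <= i <= n)%N -> annihilator_finite_length I i)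
  (F : graded_free_resolution I)
  (G : graded_free_resolution (initial_ideal I)) (i j : nat) :
  (extremal (betti F) i j <-> extremal (betti G) i j) /\
  (extremal (betti F) i j -> betti F i (i + j)%N = betti G i (i + j)%N).
Proof.
have gI := graded_ideal_hgraded hI; have [iI _] := gI.
have [iJ _] := initial_ideal_hgraded iI.
have in1 : initial_ideal I 1 <-> I 1.
  rewrite -{1}mpolyX0 (initial_idealX _ iI); split=> [/(init_mon_homog gI) [f [If df [h0 _]]]|h1].
    by rewrite mdeg0 in df; apply: (ideal_unit iI If df); rewrite -mcoeff_msupp.
  by exists 'X_[0%MM]; [rewrite mpolyX0|apply: is_initialX].
(* If I = R, then the initial ideal is R too, and [betti_unit] computes both sides. *)
have [I1|I1] := classic (I 1).
  have e k l : betti F k (k + l) = betti G k (k + l).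
    by rewrite !betti_unit //; apply/in1.
  split; last by move=> _; apply: e.
  by split=> -[h0 h]; split; [rewrite -e|move=> k l *; rewrite -e h
    |rewrite e|move=> k l *; rewrite e h].
have J1 : ~ initial_ideal I 1 by move=> /in1.
have [D hD] := annihilator_large gI hfin.
have same_dim r d (hr : (r < n)%N) : exists k,
    quot_dim (annihilator_piece I r d) (chain I r) k /\
    quot_dim (annihilator_piece (initial_ideal I) r d) (chain (initial_ideal I) r) k.
  exact: quot_dim_colon_initial.
have same_dim' r d (hr : (r < n)%N) : exists k,
    quot_dim (annihilator_piece (initial_ideal I) r d) (chain (initial_ideal I) r) k /\
    quot_dim (annihilator_piece I r d) (chain I r) k.
  by have [k []] := same_dim r d hr; exists k.
(* Equal dimensions carry the vanishing in large degrees over to the initial ideal, so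
   [extremal_compare] applies in both directions. *)
have hD' r (d : nat) p : (r < n)%N -> (D <= d)%N ->
    annihilator_piece (initial_ideal I) r d p -> chain (initial_ideal I) r p.
  move=> hr hd; have [k [qI qJ]] := same_dim r d hr; move: p.
  by apply/(quot_dim0P qJ)/(quot_dim0P qI) => p; apply: hD.
have hFG := extremal_compare (F := F) G iI iJ I1 J1 same_dim hD.
have hGF := extremal_compare (F := G) F iJ iI J1 I1 same_dim' hD'.
by split; [split=> [/hFG []|/hGF []]|move=> /hFG []].
Qed.
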